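(* $\overline{\mathcal{T}}$ is an Ore extension of the Faà di Bruno bialgebra $\mathcal{B}_{\mathrm{FdB}}$. If $\operatorname{char}\mathbb{K}=0$, then $\mathcal{B}_{\mathrm{FdB}}$ is a maximal commutative sub-bialgebra of $\overline{\mathcal{T}}$. (Here $\mathcal{B}_{\mathrm{FdB}}$ is identified, via the bialgebra isomorphism $u_{n+1}\mapsto\mathcal{E}_{\omega_n}$, $n\ge 0$, with the sub-bialgebra of $\overline{\mathcal{T}}$ generated as an algebra by $\{\mathcal{E}_{\omega_n}\mid n\ge 0\}$.)
   Context: $\mathbb{K}$ is a field and $[a,b]=ab-ba$. On words in the letters $g,h$ use the lexicographic order with $g\prec h$ (a proper prefix of a word is smaller than the word). A Lyndon word is a nonempty word $\alpha$ which is a single letter or satisfies $\alpha\prec\gamma\beta$ for every factorization $\alpha=\beta\gamma$ into nonempty words. $\alpha(g)$ is the number of occurrences of $g$ in $\alpha$. The standard factorization of a Lyndon word $\alpha$ of length at least $2$ is $\alpha=\beta\gamma$ with $\beta,\gamma$ Lyndon and $\gamma$ of maximal length. Define $E_g=g$, $E_h=h$ and $E_\alpha=[E_\beta,E_\gamma]$ for the standard factorization $\alpha=\beta\gamma$. $\mathcal{T}=\mathbb{K}\langle g,h\rangle$ is the free algebra with bialgebra structure $\Delta(g)=g\otimes g$, $\Delta(h)=1\otimes h+h\otimes g$, $\epsilon(g)=1$, $\epsilon(h)=0$. $\overline{\mathcal{T}}=\mathcal{T}/\mathcal{I}$ is the quotient bialgebra by the ideal $\mathcal{I}$ generated by all $E_\alpha$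 with $\alpha$ Lyndon and $\alpha(g)\ge 2$. For $k\ge 0$, $\omega_k=gh^k$, so $E_{\omega_0}=g$ and $E_{\omega_k}=[E_{\omega_{k-1}},h]$; $\mathcal{E}_{\omega_k}$ denotes the image of $E_{\omega_k}$ in $\overline{\mathcal{T}}$. The Faà di Bruno bialgebra $\mathcal{B}_{\mathrm{FdB}}$ is the polynomial algebra $\mathbb{K}[u_1,u_2,\ldots]$ with $\epsilon(u_n)=\delta_{n,1}$ and $\Delta(u_n)=\sum_{k=1}^n u_k\otimes B_{n,k}(u_1,\ldots,u_n)$, where $$B_{n,k}(u_1,\ldots,u_n)=\sum_{\substack{k_1+k_2+\cdots+k_n=k\\ k_1+2k_2+\cdots+nk_n=n}}\frac{n!}{k_1!k_2!\cdots k_n!}\Big(\frac{u_1}{1!}\Big)^{k_1}\Big(\frac{u_2}{2!}\Big)^{k_2}\cdots\Big(\frac{u_n}{n!}\Big)^{k_n}$$ is the partial Bell polynomial (a polynomial with integer coefficients, interpreted over $\mathbb{K}$). Ore extension: a ring $S\supseteq R$ is an Ore extension $R[x;\sigma,\delta]$ of $R$ if $\sigma$ is an endomorphism of $R$, $\delta$ is an additive map $R\to R$ with $\delta(ab)=\delta(a)\sigma(b)+a\delta(b)$, $x\in S$, $ax=x\sigma(a)+\delta(a)$ for all $a\in R$, and $S$ is a free right $R$-module with basis $\{x^i\mid i\ge 0\}$. *)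

(* Defs.v *)
From HB Require Import structures.
From mathcomp Require Import all_boot all_order all_algebra.
From mathcomp Require Import boolp classical_sets.
From mathcomp Require Import finmap.
From mathcomp Require Import monalg.
Set Implicit Arguments.
Unset Strict Implicit.
Unset Printing Implicit Defensive.
Import Order.TTheory GRing.Theory.
Local Open Scope ring_scope.
Local Open Scope quotient_scope.
Local Open Scope classical_set_scope.

Definition bilinear_map (K : comNzRingType) (A B V : lmodType K)
    (f : A -> B -> V) : Prop :=
  (forall b, linear (f^~ b)) /\ (forall a, linear (f a)).

(* A list [:: (a1, b1); ...; (ar, br)] stands for a1 (x) b1 + ... + ar (x) br.
   Two lists give the same tensor when no bilinear map out of A * B separates
   them. *)
Section TensorDef.
Variables (K : comNzRingType) (A B : lmodType K).

Definition bisum (V : lmodType K) (f : A -> B -> V) (s : seq (A * B)) : V :=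
  \sum_(p <- s) f p.1 p.2.

Definition tensor_eqv : rel (seq (A * B)) := fun s t =>
  `[< forall (V : lmodType K) (f : A -> B -> V),
        bilinear_map f -> bisum f s = bisum f t >].

Lemma tensor_eqv_refl : reflexive tensor_eqv.
Proof. by move=> s; apply/asboolP. Qed.

Lemma tensor_eqv_sym : symmetric tensor_eqv.
Proof.
by move=> s t; apply/asboolP/asboolP => st V f bf; rewrite (st V f bf).
Qed.

Lemma tensor_eqv_trans : transitive tensor_eqv.
Proof.
move=> t s u /asboolP st /asboolP tu; apply/asboolP => V f bf.
by rewrite (st V f bf) (tu V f bf).
Qed.

Canonical tensor_equiv_rel :=
  EquivRel tensor_eqv tensor_eqv_refl tensor_eqv_sym tensor_eqv_trans.

Definition tensor := {eq_quot tensor_equiv_rel}.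

HB.instance Definition _ := Choice.on tensor.
HB.instance Definition _ := EqQuotient.on tensor.

Definition tens (a : A) (b : B) : tensor := \pi_tensor [:: (a, b)].

(* The linear map out of the tensor product induced by f; it is meaningful
   only when f is bilinear. *)
Definition tensor_lift (V : lmodType K) (f : A -> B -> V) (x : tensor) : V :=
  bisum f (repr x).

Lemma tensor_lift_pi (V : lmodType K) (f : A -> B -> V) s :
  bilinear_map f -> tensor_lift f (\pi_tensor s) = bisum f s.
Proof.
move=> bf; rewrite /tensor_lift.
by have /eqmodP/asboolP/(_ V f bf) := reprK (\pi_tensor s).
Qed.

Lemma tensorP (x y : tensor) :
  (forall (V : lmodType K) (f : A -> B -> V),
     bilinear_map f -> tensor_lift f x = tensor_lift f y) -> x = y.
Proof.
move=> xy; rewrite -[x]reprK -[y]reprK; apply/eqmodP/asboolP => V f bf.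
exact: xy.
Qed.

Definition tensor_add (x y : tensor) : tensor := \pi_tensor (repr x ++ repr y).
Definition tensor_zero : tensor := \pi_tensor [::].
Definition tensor_scale (c : K) (x : tensor) : tensor :=
  \pi_tensor [seq (c *: p.1, p.2) | p <- repr x].
Definition tensor_opp (x : tensor) : tensor := tensor_scale (-1) x.

Section Lift.
Variables (V : lmodType K) (f : A -> B -> V).
Hypothesis bf : bilinear_map f.

Lemma tensor_lift_add x y :
  tensor_lift f (tensor_add x y) = tensor_lift f x + tensor_lift f y.
Proof. by rewrite tensor_lift_pi // /bisum big_cat. Qed.

Lemma tensor_lift_zero : tensor_lift f tensor_zero = 0.
Proof. by rewrite tensor_lift_pi // /bisum big_nil. Qed.

Lemma tensor_lift_scale c x :
  tensor_lift f (tensor_scale c x) = c *: tensor_lift f x.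
Proof.
rewrite tensor_lift_pi // /bisum big_map scaler_sumr; apply: eq_bigr => p _ /=.
exact: (scalable_linear (bf.1 p.2)).
Qed.

Lemma tensor_lift_opp x : tensor_lift f (tensor_opp x) = - tensor_lift f x.
Proof. by rewrite tensor_lift_scale scaleN1r. Qed.

End Lift.

Definition tensor_liftE := (tensor_lift_add, tensor_lift_zero,
  tensor_lift_scale, tensor_lift_opp).

Lemma tensor_addA : associative tensor_add.
Proof. by move=> x y z; apply: tensorP => V f bf; rewrite !tensor_liftE ?addrA. Qed.
Lemma tensor_addC : commutative tensor_add.
Proof. by move=> x y; apply: tensorP => V f bf; rewrite !tensor_liftE // addrC. Qed.
Lemma tensor_add0 : left_id tensor_zero tensor_add.
Proof. by move=> x; apply: tensorP => V f bf; rewrite !tensor_liftE // add0r. Qed.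
Lemma tensor_addN : left_inverse tensor_zero tensor_opp tensor_add.
Proof. by move=> x; apply: tensorP => V f bf; rewrite !tensor_liftE // addNr. Qed.

HB.instance Definition _ := GRing.isZmodule.Build tensor
  tensor_addA tensor_addC tensor_add0 tensor_addN.

Lemma tensor_scaleA a b (x : tensor) :
  tensor_scale a (tensor_scale b x) = tensor_scale (a * b) x.
Proof. by apply: tensorP => V f bf; rewrite !tensor_liftE // scalerA. Qed.
Lemma tensor_scale1 : left_id 1 tensor_scale.
Proof. by move=> x; apply: tensorP => V f bf; rewrite !tensor_liftE // scale1r. Qed.
Lemma tensor_scaleDr : right_distributive tensor_scale +%R.
Proof.
by move=> a x y; apply: tensorP => V f bf; rewrite !tensor_liftE // scalerDr.
Qed.
Lemma tensor_scaleDl x :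
  {morph tensor_scale^~ x : a b / a + b >-> a + b}.
Proof.
by move=> a b; apply: tensorP => V f bf; rewrite !tensor_liftE // scalerDl.
Qed.

HB.instance Definition _ := GRing.Zmodule_isLmodule.Build K tensor
  tensor_scaleA tensor_scale1 tensor_scaleDr tensor_scaleDl.

End TensorDef.

Notation "a ⊗ b" := (tens a b) (at level 35, no associativity) : ring_scope.

Definition tensor_map (K : comNzRingType) (A B A' B' : lmodType K)
    (f : A -> A') (g : B -> B') : tensor A B -> tensor A' B' :=
  tensor_lift (fun a b => f a ⊗ g b).

Definition tensor_assoc (K : comNzRingType) (A B C : lmodType K) :
    tensor (tensor A B) C -> tensor A (tensor B C) :=
  tensor_lift (fun t c => tensor_lift (fun a b => a ⊗ (b ⊗ c)) t).

Section TensorAlg.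
Variables (K : comNzRingType) (A B : algType K).
Implicit Types x y z : tensor A B.

Definition tensor_one : tensor A B := 1 ⊗ 1.

Definition tensor_mul x y : tensor A B :=
  \pi_(tensor A B) [seq (p.1 * q.1, p.2 * q.2) | p <- repr x, q <- repr y].

Section Lift.
Variables (V : lmodType K) (f : A -> B -> V).
Hypothesis bf : bilinear_map f.

Lemma bilinear_mulr a b : bilinear_map (fun a' b' => f (a' * a) (b' * b)).
Proof.
split=> [b' k u v|a' k u v] /=; first by rewrite mulrDl -scalerAl bf.1.
by rewrite mulrDl -scalerAl bf.2.
Qed.

Lemma bilinear_mull a b : bilinear_map (fun a' b' => f (a * a') (b * b')).
Proof.
split=> [b' k u v|a' k u v] /=; first by rewrite mulrDr -scalerAr bf.1.
by rewrite mulrDr -scalerAr bf.2.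
Qed.

Lemma tensor_lift_one : tensor_lift f tensor_one = f 1 1.
Proof. by rewrite tensor_lift_pi // /bisum big_seq1. Qed.

Lemma tensor_lift_mul x y : tensor_lift f (tensor_mul x y) =
  tensor_lift (fun a b => tensor_lift (fun a' b' => f (a * a') (b * b')) y) x.
Proof. by rewrite tensor_lift_pi // /bisum big_allpairs_dep. Qed.

Lemma tensor_lift_mulC x y : tensor_lift f (tensor_mul x y) =
  tensor_lift (fun a' b' => tensor_lift (fun a b => f (a * a') (b * b')) x) y.
Proof. by rewrite tensor_lift_mul /tensor_lift /bisum exchange_big. Qed.

Lemma bilinear_liftr y : bilinear_map
  (fun a b => tensor_lift (fun a' b' => f (a * a') (b * b')) y).
Proof.
split=> [b' k u v|a' k u v]; rewrite /tensor_lift /bisum scaler_sumr -big_split;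
  apply: eq_bigr => p _ /=.
  exact: (bilinear_mulr p.1 p.2).1.
exact: (bilinear_mulr p.1 p.2).2.
Qed.

Lemma bilinear_liftl x : bilinear_map
  (fun a' b' => tensor_lift (fun a b => f (a * a') (b * b')) x).
Proof.
split=> [b' k u v|a' k u v]; rewrite /tensor_lift /bisum scaler_sumr -big_split;
  apply: eq_bigr => p _ /=.
  exact: (bilinear_mull p.1 p.2).1.
exact: (bilinear_mull p.1 p.2).2.
Qed.

End Lift.

Lemma tensor_mulA : associative tensor_mul.
Proof.
move=> x y z; apply: tensorP => V f bf.
rewrite tensor_lift_mul // [RHS]tensor_lift_mul // [RHS]tensor_lift_mul; last first.
  exact: bilinear_liftr.
apply: eq_bigr => p _; rewrite tensor_lift_mul; last exact: bilinear_mull.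
by apply: eq_bigr => q _; apply: eq_bigr => r _; rewrite !mulrA.
Qed.

Lemma tensor_mul1 : left_id tensor_one tensor_mul.
Proof.
move=> x; apply: tensorP => V f bf; rewrite tensor_lift_mul //.
rewrite tensor_lift_one; last exact: bilinear_liftr.
by apply: eq_bigr => p _; rewrite !mul1r.
Qed.

Lemma tensor_mulr1 : right_id tensor_one tensor_mul.
Proof.
move=> x; apply: tensorP => V f bf; rewrite tensor_lift_mulC //.
rewrite tensor_lift_one; last exact: bilinear_liftl.
by apply: eq_bigr => p _; rewrite !mulr1.
Qed.

Lemma tensor_mulDl : left_distributive tensor_mul +%R.
Proof.
move=> x y z; apply: tensorP => V f bf.
rewrite tensor_lift_mul // tensor_lift_add; last exact: bilinear_liftr.
by rewrite tensor_lift_add // !tensor_lift_mul.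
Qed.

Lemma tensor_mulDr : right_distributive tensor_mul +%R.
Proof.
move=> x y z; apply: tensorP => V f bf.
rewrite tensor_lift_mulC // tensor_lift_add; last exact: bilinear_liftl.
by rewrite tensor_lift_add // !tensor_lift_mulC.
Qed.

HB.instance Definition _ := GRing.Zmodule_isPzRing.Build (tensor A B)
  tensor_mulA tensor_mul1 tensor_mulr1 tensor_mulDl tensor_mulDr.

End TensorAlg.

Definition is_bialgebra (K : fieldType) (A : algType K)
    (Delta : A -> tensor A A) (eps : A -> K) : Prop :=
  [/\ linear Delta /\ monoid_morphism Delta,
      scalar eps /\ monoid_morphism eps,
      forall a, tensor_assoc (tensor_map Delta id (Delta a)) =
                tensor_map id Delta (Delta a),
      forall a, tensor_lift (fun x y => eps x *: y) (Delta a) = a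
    & forall a, tensor_lift (fun x y => eps y *: x) (Delta a) = a].

Definition bialgebra_morphism (K : fieldType) (A B : algType K)
    (DeltaA : A -> tensor A A) (epsA : A -> K)
    (DeltaB : B -> tensor B B) (epsB : B -> K) (f : A -> B) : Prop :=
  [/\ linear f, monoid_morphism f,
      forall a, DeltaB (f a) = tensor_map f f (DeltaA a)
    & forall a, epsB (f a) = epsA a].

Definition subalgebra (K : fieldType) (A : algType K) (C : set A) : Prop :=
  [/\ C 1, forall (k : K) x y, C x -> C y -> C (k *: x + y)
    & forall x y, C x -> C y -> C (x * y)].

Definition sub_bialgebra (K : fieldType) (A : algType K)
    (Delta : A -> tensor A A) (C : set A) : Prop :=
  subalgebra C /\
  forall c, C c -> exists s : seq (A * A),
    (forall p, p \in s -> C p.1 /\ C p.2) /\ Delta c = \sum_(p <- s) p.1 ⊗ p.2.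

Definition commutative_on (R : pzRingType) (C : set R) : Prop :=
  forall x y, C x -> C y -> x * y = y * x.

Definition maximal_commutative_sub_bialgebra (K : fieldType) (A : algType K)
    (Delta : A -> tensor A A) (C : set A) : Prop :=
  [/\ sub_bialgebra Delta C, commutative_on C
    & forall D : set A, sub_bialgebra Delta D -> commutative_on D ->
        C `<=` D -> D = C].

(* R is regarded as a subring of S through the injective morphism iota. *)
Definition is_ore_extension (R S : pzRingType) (iota : R -> S)
    (x : S) (sigma delta : R -> R) : Prop :=
  [/\ zmod_morphism iota, monoid_morphism iota & injective iota] /\
  [/\ zmod_morphism sigma /\ monoid_morphism sigma,
      zmod_morphism delta /\
        (forall a b, delta (a * b) = delta a * sigma b + a * delta b),
      forall a, iota a * x = x * iota (sigma a) + iota (delta a),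
      forall s, exists n (r : 'I_n -> R), s = \sum_(i < n) x ^+ i * iota (r i)
    & forall n (r : 'I_n -> R), \sum_(i < n) x ^+ i * iota (r i) = 0 ->
        forall i, r i = 0].

Definition two_sided_ideal (R : pzRingType) (J : set R) : Prop :=
  [/\ J 0, forall x y, J x -> J y -> J (x + y)
    & forall a b x, J x -> J (a * x * b)].

Lemma smallest_two_sided_ideal (R : pzRingType) (S : set R) :
  two_sided_ideal (smallest (@two_sided_ideal R) S).
Proof.
split=> [J [[J0 _ _] _] //|x y Jx Jy J [idJ SJ]|a b x Jx J [idJ SJ]].
  by have [_ JD _] := idJ; apply: JD; [exact: Jx|exact: Jy].
by have [_ _ JM] := idJ; apply: JM; exact: Jx.
Qed.

Record proper_ideal (R : pzRingType) := ProperIdeal {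
  ideal_set :> R -> Prop;
  ideal_two_sided : two_sided_ideal ideal_set;
  ideal_proper : ~ ideal_set 1 }.

Section QuotientAlgebra.
Variables (K : comNzRingType) (A : algType K) (J : proper_ideal A).

Lemma ideal0 : J 0.
Proof. by case: (ideal_two_sided J). Qed.
Lemma idealD x y : J x -> J y -> J (x + y).
Proof. by case: (ideal_two_sided J) => _ + _; apply. Qed.
Lemma idealMl a x : J x -> J (a * x).
Proof. by case: (ideal_two_sided J) => _ _ JM /(JM a 1); rewrite mulr1. Qed.
Lemma idealMr a x : J x -> J (x * a).
Proof. by case: (ideal_two_sided J) => _ _ JM /(JM 1 a); rewrite mul1r. Qed.
Lemma idealZ (k : K) x : J x -> J (k *: x).
Proof. by move=> Jx; rewrite -mulr_algl; apply: idealMl. Qed.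
Lemma idealN x : J x -> J (- x).
Proof. by rewrite -scaleN1r; apply: idealZ. Qed.

Definition congr_ideal : rel A := fun x y => `[< J (x - y) >].

Lemma congr_ideal_refl : reflexive congr_ideal.
Proof. by move=> x; apply/asboolP; rewrite subrr; apply: ideal0. Qed.
Lemma congr_ideal_sym : symmetric congr_ideal.
Proof.
by move=> x y; apply/asboolP/asboolP => /idealN; rewrite opprB.
Qed.
Lemma congr_ideal_trans : transitive congr_ideal.
Proof.
move=> y x z /asboolP xy /asboolP yz; apply/asboolP.
by rewrite -(subrKA y); apply: idealD.
Qed.

Canonical congr_ideal_equiv_rel :=
  EquivRel congr_ideal congr_ideal_refl congr_ideal_sym congr_ideal_trans.

Definition quot_alg := {eq_quot congr_ideal_equiv_rel}.

HB.instance Definition _ := Choice.on quot_alg.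
HB.instance Definition _ := EqQuotient.on quot_alg.

Definition quot_pi (a : A) : quot_alg := \pi_quot_alg a.

Lemma quot_piP a b : J (a - b) -> quot_pi a = quot_pi b.
Proof. by move=> ab; apply/eqmodP/asboolP. Qed.

Lemma quot_pi_inj a b : quot_pi a = quot_pi b -> J (a - b).
Proof. by move=> /eqmodP/asboolP. Qed.

Lemma quot_piK (x : quot_alg) : quot_pi (repr x) = x.
Proof. exact: reprK. Qed.

Lemma quot_repr a : J (repr (quot_pi a) - a).
Proof. by apply: quot_pi_inj; rewrite quot_piK. Qed.

Definition quot_add (x y : quot_alg) := quot_pi (repr x + repr y).
Definition quot_opp (x : quot_alg) := quot_pi (- repr x).
Definition quot_mul (x y : quot_alg) := quot_pi (repr x * repr y).
Definition quot_scale (k : K) (x : quot_alg) := quot_pi (k *: repr x).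

Lemma quot_addE a b : quot_add (quot_pi a) (quot_pi b) = quot_pi (a + b).
Proof. by apply: quot_piP; rewrite opprD addrACA; apply: idealD; apply: quot_repr. Qed.
Lemma quot_oppE a : quot_opp (quot_pi a) = quot_pi (- a).
Proof. by apply: quot_piP; rewrite -opprD; apply/idealN/quot_repr. Qed.
Lemma quot_mulE a b : quot_mul (quot_pi a) (quot_pi b) = quot_pi (a * b).
Proof.
apply: quot_piP; rewrite -(subrKA (a * repr (quot_pi b))) -mulrBl -mulrBr.
by apply: idealD; [apply: idealMr|apply: idealMl]; apply: quot_repr.
Qed.
Lemma quot_scaleE k a : quot_scale k (quot_pi a) = quot_pi (k *: a).
Proof. by apply: quot_piP; rewrite -scalerBr; apply/idealZ/quot_repr. Qed.

Lemma quot_ind (P : quot_alg -> Prop) : (forall a, P (quot_pi a)) -> forall x, P x.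
Proof. by move=> Ppi x; rewrite -[x]quot_piK. Qed.

Lemma quot_addA : associative quot_add.
Proof. by do 3![elim/quot_ind=> ?]; rewrite !quot_addE addrA. Qed.
Lemma quot_addC : commutative quot_add.
Proof. by do 2![elim/quot_ind=> ?]; rewrite !quot_addE addrC. Qed.
Lemma quot_add0 : left_id (quot_pi 0) quot_add.
Proof. by elim/quot_ind=> ?; rewrite quot_addE add0r. Qed.
Lemma quot_addN : left_inverse (quot_pi 0) quot_opp quot_add.
Proof. by elim/quot_ind=> ?; rewrite quot_oppE quot_addE addNr. Qed.

HB.instance Definition _ := GRing.isZmodule.Build quot_alg
  quot_addA quot_addC quot_add0 quot_addN.

Lemma quot_piD a b : quot_pi (a + b) = quot_pi a + quot_pi b.
Proof. by rewrite -quot_addE. Qed.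

Lemma quot_mulA : associative quot_mul.
Proof. by do 3![elim/quot_ind=> ?]; rewrite !quot_mulE mulrA. Qed.
Lemma quot_mul1 : left_id (quot_pi 1) quot_mul.
Proof. by elim/quot_ind=> ?; rewrite quot_mulE mul1r. Qed.
Lemma quot_mulr1 : right_id (quot_pi 1) quot_mul.
Proof. by elim/quot_ind=> ?; rewrite quot_mulE mulr1. Qed.
Lemma quot_mulDl : left_distributive quot_mul quot_add.
Proof.
by do 3![elim/quot_ind=> ?]; rewrite !(quot_addE, quot_mulE) mulrDl.
Qed.
Lemma quot_mulDr : right_distributive quot_mul quot_add.
Proof.
by do 3![elim/quot_ind=> ?]; rewrite !(quot_addE, quot_mulE) mulrDr.
Qed.
Lemma quot_one_neq0 : quot_pi 1 != 0.
Proof.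
by apply/eqP => /quot_pi_inj; rewrite subr0; apply: ideal_proper.
Qed.

HB.instance Definition _ := GRing.Zmodule_isNzRing.Build quot_alg
  quot_mulA quot_mul1 quot_mulr1 quot_mulDl quot_mulDr quot_one_neq0.

Lemma quot_scaleA a b x :
  quot_scale a (quot_scale b x) = quot_scale (a * b) x.
Proof. by elim/quot_ind: x => ?; rewrite !quot_scaleE scalerA. Qed.
Lemma quot_scale1 : left_id 1 quot_scale.
Proof. by elim/quot_ind=> ?; rewrite quot_scaleE scale1r. Qed.
Lemma quot_scaleDr : right_distributive quot_scale +%R.
Proof.
move=> k; do 2![elim/quot_ind=> ?].
by rewrite -quot_piD !quot_scaleE scalerDr quot_piD.
Qed.
Lemma quot_scaleDl x : {morph quot_scale^~ x : a b / a + b >-> a + b}.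
Proof.
by elim/quot_ind: x => x a b; rewrite !quot_scaleE -quot_piD scalerDl.
Qed.

HB.instance Definition _ := GRing.Zmodule_isLmodule.Build K quot_alg
  quot_scaleA quot_scale1 quot_scaleDr quot_scaleDl.

Lemma quot_scaleAl (k : K) (x y : quot_alg) : k *: (x * y) = k *: x * y.
Proof.
elim/quot_ind: x => x; elim/quot_ind: y => y.
by rewrite -[LHS]/(quot_scale k (quot_mul _ _))
           -[RHS]/(quot_mul (quot_scale k _) _) !(quot_mulE, quot_scaleE) scalerAl.
Qed.
Lemma quot_scaleAr (k : K) (x y : quot_alg) : k *: (x * y) = x * (k *: y).
Proof.
elim/quot_ind: x => x; elim/quot_ind: y => y.
by rewrite -[LHS]/(quot_scale k (quot_mul _ _))
           -[RHS]/(quot_mul _ (quot_scale k _)) !(quot_mulE, quot_scaleE) scalerAr.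
Qed.

HB.instance Definition _ :=
  GRing.Lmodule_isLalgebra.Build K quot_alg quot_scaleAl.
HB.instance Definition _ :=
  GRing.Lalgebra_isAlgebra.Build K quot_alg quot_scaleAr.

End QuotientAlgebra.

(* The library orders bool by false < true. *)
Definition g : bool := false.
Definition h : bool := true.
Definition word := seqlexi bool.

(* rot i w = drop i w ++ take i w is the word gamma beta associated with the
   factorization w = beta gamma in which beta has length i. *)
Definition lyndon (w : word) : bool :=
  (w != [::]) && all (fun i => w < (rot i w : word))%O (iota 1 (size w).-1).

(* The length of beta in the standard factorization w = beta gamma: gamma is
   longest when beta is shortest. *)
Definition std_cut (w : word) : nat :=
  head 0%N [seq i <- iota 1 (size w).-1 | lyndon (take i w) && lyndon (drop i w)].

Definition omega (k : nat) : word := g :: nseq k h.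

Definition commutator (R : pzRingType) (a b : R) : R := a * b - b * a.

Definition free_alg (K : fieldType) := {malg K[{fmonom bool}]}.

Section FreeAlgebra.
Variable K : fieldType.
Local Notation T := (free_alg K).

HB.instance Definition _ := GRing.Lalgebra.on T.

Lemma free_alg_scaleAr (k : K) (x y : T) : k *: (x * y) = x * (k *: y).
Proof.
apply/malgP => m.
rewrite mcoeffZ mcoeffMr (mcoeffMrw _ (fsubset_refl _) (msuppZ_le _ _)).
rewrite mulr_sumr; apply: eq_bigr => w2 _; rewrite mulr_sumr.
by apply: eq_bigr => w1 _; rewrite mcoeffZ mulrCA mulrnAr.
Qed.
HB.instance Definition _ := GRing.Lalgebra_isAlgebra.Build K T free_alg_scaleAr.

Definition letter (a : bool) : T := << fmu a >>.

Definition letter_comul (a : bool) : tensor T T :=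
  if a == g then letter g ⊗ letter g else 1 ⊗ letter h + letter h ⊗ letter g.

Definition letter_counit (a : bool) : K := if a == g then 1 else 0.

Definition free_comul (p : T) : tensor T T :=
  \sum_(w <- msupp p) p@_w *: \prod_(a <- (w : seq bool)) letter_comul a.

Definition free_counit (p : T) : K :=
  \sum_(w <- msupp p) p@_w * \prod_(a <- (w : seq bool)) letter_counit a.

(* n bounds the length of w. *)
Fixpoint lyndon_bracket_rec (n : nat) (w : word) : T :=
  match n, w with
  | n'.+1, [:: a] => letter a
  | n'.+1, _ => commutator (lyndon_bracket_rec n' (take (std_cut w) w))
                           (lyndon_bracket_rec n' (drop (std_cut w) w))
  | 0, _ => 0
  end.

Definition E (w : word) : T := lyndon_bracket_rec (size w) w.

Definition ideal_generators : set T :=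
  [set E w | w in [set w | lyndon w /\ (2 <= count_mem g w)%N]].

Definition I_set : set T := smallest (@two_sided_ideal T) ideal_generators.

(* The augmentation sending g and h to 0 kills every commutator. *)
Lemma I_set_proper : ~ I_set 1.
Proof.
pose J : set T := [set p : {malg K[{fmonom bool}]} | p@_mone = 0].
move=> /(_ J) J1; suff /J1 : two_sided_ideal J /\ ideal_generators `<=` J.
  by rewrite /J /= rmorph1 => /eqP; rewrite oner_eq0.
split.
  split=> [|x y|a b x]; rewrite /J /=; first by rewrite mcoeff0.
    by rewrite mcoeffD => -> ->; rewrite addr0.
  by rewrite !rmorphM /= => ->; rewrite mulr0 mul0r.
move=> _ [w _ <-]; rewrite /J /E /=.
have aug_bracket n v : (lyndon_bracket_rec n v)@_mone = 0.
  case: n v => [|n] [|a [|b v]]; rewrite ?mcoeff0 //=.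
  - by rewrite /commutator rmorphB !rmorphM /= mulrC subrr.
  - by rewrite mcoeffU1 -[_ == _]negbK fm1_eq1.
  by rewrite /commutator rmorphB !rmorphM /= mulrC subrr.
exact: aug_bracket.
Qed.

Definition I_ideal : proper_ideal T :=
  ProperIdeal (smallest_two_sided_ideal ideal_generators) I_set_proper.

Definition Tbar := quot_alg I_ideal.

HB.instance Definition _ := GRing.Algebra.on Tbar.

Definition Tbar_pi : T -> Tbar := quot_pi I_ideal.

(* Defined on representatives; that these descend to the quotient, i.e. that
   I_ideal is a bi-ideal, is expressed by saying that Tbar_pi is a bialgebra
   morphism. *)
Definition Tbar_comul (x : Tbar) : tensor Tbar Tbar :=
  tensor_map Tbar_pi Tbar_pi (free_comul (repr x)).

Definition Tbar_counit (x : Tbar) : K := free_counit (repr x).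

Definition calE (n : nat) : Tbar := Tbar_pi (E (omega n)).

End FreeAlgebra.

Definition FdB (K : fieldType) := {malg K[{cmonom nat}]}.

Section FaaDiBruno.
Variable K : fieldType.

HB.instance Definition _ := GRing.ComAlgebra.on (FdB K).

(* The variable with index i : nat is u_(i+1). *)
Definition u (i : nat) : FdB K := << ucm i >>.

(* m j is the exponent of u_(j+1); the quotient of factorials is exact. *)
Definition bell (n k : nat) : FdB K :=
  \sum_(m : {ffun 'I_n -> 'I_n.+1} |
          ((\sum_j m j == k) && (\sum_(j < n) j.+1 * m j == n))%N)
    (n`! %/ \prod_(j < n) ((m j)`! * j.+1`! ^ m j))%N%:R
      *: \prod_(j < n) u j ^+ m j.

Definition u_comul (i : nat) : tensor (FdB K) (FdB K) :=
  \sum_(k < i.+1) u k ⊗ bell i.+1 k.+1.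

Definition u_counit (i : nat) : K := (i == 0%N)%:R.

Definition FdB_comul (p : FdB K) : tensor (FdB K) (FdB K) :=
  \sum_(m <- msupp p) p@_m *: \prod_(i <- finsupp m) u_comul i ^+ m i.

Definition FdB_counit (p : FdB K) : K :=
  \sum_(m <- msupp p) p@_m * \prod_(i <- finsupp m) u_counit i ^+ m i.

End FaaDiBruno.

(* Main.v *)
From HB Require Import structures.
Require Import Defs.
From mathcomp Require Import all_boot all_order all_algebra.
From mathcomp Require Import boolp classical_sets.
From mathcomp Require Import finmap monalg zify.
Import Order.TTheory GRing.Theory.
Local Open Scope ring_scope.
Local Open Scope quotient_scope.
Local Open Scope classical_set_scope.

Set Implicit Arguments.
Unset Strict Implicit.
Unset Printing Implicit Defensive.

(** Write R for the polynomial algebra in u_1, u_2, ... and e_k for the image in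
    the quotient of the iterated commutator [..[[g, h], h].., h] with k letters h.
    (In the code the variables are numbered from 0.)

    The ideal. A Lyndon word with a single g is g h^k. By induction along
    standard factorizations, the bracket of a Lyndon word with at least two g
    lies in the ideal generated by the commutators of the iterated brackets
    ([I_set_sub]); conversely, for i < j the word g h^i g h^j is Lyndon and its
    bracket is exactly such a commutator ([I_set_commutator]). So the quotient is
    presented by g, h and the relations saying that the e_k commute, and
    u_(k+1) |-> e_k defines an algebra morphism phi from R.

    The Ore extension. Since e_k h = h e_k + e_(k+1), we have
    phi(a) h = h phi(a) + phi(D a), where D is the derivation of R with
    D u_k = u_(k+1) ([phi_x]). Hence every element of the quotient is a sum of
    h^i phi(r_i). To see that the r_i are unique, let the free algebra act on the
    right on the polynomials R[X] as it would on normal forms: g multiplies by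
    u_1, and h sends p to X p + D p. Then the iterated bracket with k letters h
    multiplies by u_(k+1) ([act_iter_ad]), so that the ideal acts by zero, and a
    normal form acting on 1 returns its own coefficients ([ore_extension]). In
    particular phi is injective and has a linear retraction.

    The bialgebras. Applying the comultiplication to e_(n+1) = [e_n, h] gives a
    recursion for the coefficients in
    Delta(e_n) = sum_k e_k (x) phi(B_(n+1,k+1)), namely
    B_(n+1,k+1) = D B_(n,k+1) + u_1 B_(n,k) ([comul_iter_ad]). For the explicit
    polynomials it follows from B_(n+1,k+1) = sum_i binomial(n, i) u_(i+1)
    B_(n-i,k), which is an identity between integer coefficients
    ([bell_coef_sum], [bell_rec], [bell_step]). So the Delta(e_n) commute, hence
    the ideal is a coideal and the quotient is a bialgebra, whose axioms are
    checked on the images of g and h; and phi respects comultiplications, so the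
    axioms for the Faa di Bruno bialgebra are inherited through the injective
    map phi ([bialgebra_injective]).

    Maximality. If d has degree n > 0 in h with leading coefficient p, then the
    coefficient of h^(n-1) in the commutator of d with e_0 is n u_2 p up to sign.
    In characteristic 0 it is nonzero, so only elements of phi(R) commute with
    e_0 ([commuting_in_range]). *)

(** * Linear, bilinear and multiplicative extension *)

Section Linear.
Variables (K : comNzRingType) (U V : lmodType K) (f : U -> V).
Hypothesis lf : linear f.

Lemma linZ k x : f (k *: x) = k *: f x.
Proof. exact: (scalable_linear lf). Qed.

Lemma lin0 : f 0 = 0.
Proof. by have := linZ 0 0; rewrite !scale0r. Qed.

Lemma linD : {morph f : x y / x + y}.
Proof. by move=> x y; rewrite -[x in LHS]scale1r lf scale1r. Qed.

Lemma linB : {morph f : x y / x - y}.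
Proof. by move=> x y; rewrite addrC -scaleN1r lf scaleN1r addrC. Qed.

Lemma lin_sum I (r : seq I) (P : pred I) (x : I -> U) :
  f (\sum_(i <- r | P i) x i) = \sum_(i <- r | P i) f (x i).
Proof. exact: (big_morph f linD lin0). Qed.

End Linear.

Lemma lin_comp (K : comNzRingType) (U V W : lmodType K) (f : V -> W) (g : U -> V) :
  linear f -> linear g -> linear (f \o g).
Proof. by move=> lf lg k x y; rewrite /= lg lf. Qed.

Lemma lin_id (K : comNzRingType) (U : lmodType K) : linear (@id U).
Proof. by []. Qed.

Section Bilinear.
Variable K : comNzRingType.

Lemma bilinear_comp (U U' V W Z : lmodType K) (f : U -> V) (f' : U' -> W)
    (b : V -> W -> Z) :
  linear f -> linear f' -> bilinear_map b -> bilinear_map (fun x y => b (f x) (f' y)).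
Proof.
move=> lf lf' [bl br]; split=> [y|x] k a a' /=; first by rewrite lf bl.
by rewrite lf' br.
Qed.

Lemma bilinear_lin (U U' V W : lmodType K) (f : V -> W)
    (b : U -> U' -> V) :
  linear f -> bilinear_map b -> bilinear_map (fun x y => f (b x y)).
Proof.
move=> lf [bl br]; split=> [y|x] k a a' /=; first by rewrite bl lf.
by rewrite br lf.
Qed.

Lemma bilinear_add (U U' V : lmodType K) (b b' : U -> U' -> V) :
  bilinear_map b -> bilinear_map b' -> bilinear_map (fun x y => b x y + b' x y).
Proof.
move=> [bl br] [bl' br']; split=> [y|x] k a a' /=.
  by rewrite bl bl' scalerDr addrACA.
by rewrite br br' scalerDr addrACA.
Qed.

Lemma alg_mul_bilinear (A : algType K) : bilinear_map (fun x y : A => x * y).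
Proof. by split=> [b|a] k x y; rewrite ?mulrDl ?mulrDr -?scalerAl -?scalerAr. Qed.

End Bilinear.

Section LinearExtension.
Variables (K : comNzRingType) (M : monomType).
Local Notation A := {malg K[M]}.

Definition lin_ext (V : lmodType K) (H : M -> V) (p : A) : V :=
  \sum_(m <- msupp p) p@_m *: H m.

Lemma lin_extEw (V : lmodType K) (H : M -> V) (d : {fset M}) (p : A) :
  (msupp p `<=` d)%fset -> lin_ext H p = \sum_(m <- d) p@_m *: H m.
Proof.
move=> pd; rewrite /lin_ext (big_fset_incl _ pd) //= => m _ /mcoeff_outdom->.
by rewrite scale0r.
Qed.

Lemma lin_ext_linear (V : lmodType K) (H : M -> V) : linear (lin_ext H).
Proof.
move=> k p q; pose d := (msupp p `|` msupp q)%fset.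
have pd : (msupp p `<=` d)%fset by rewrite fsubsetUl.
have qd : (msupp q `<=` d)%fset by rewrite fsubsetUr.
have pqd : (msupp (k *: p + q) `<=` d)%fset.
  apply: fsubset_trans (msuppD_le _ _) _.
  by rewrite fsubUset qd andbT (fsubset_trans (msuppZ_le _ _)).
rewrite !(lin_extEw _ pd, lin_extEw _ qd, lin_extEw _ pqd) scaler_sumr -big_split.
by apply: eq_bigr => m _; rewrite mcoeffD mcoeffZ scalerDl scalerA.
Qed.

Lemma lin_extU (V : lmodType K) (H : M -> V) m : lin_ext H << m >> = H m.
Proof. by rewrite (lin_extEw _ msuppU_le) big_seq_fset1 mcoeffUU scale1r. Qed.

Lemma malg_sum (p : A) : p = \sum_(m <- msupp p) p@_m *: (<< m >> : A).
Proof.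
rewrite {1}[p]monalgE; apply: eq_bigr => m _; apply/malgP => m'.
by rewrite mcoeffZ !mcoeffU mulrnAr mulr1.
Qed.

Lemma malg_linear_eq (V : lmodType K) (f f' : A -> V) :
  linear f -> linear f' -> (forall m, f << m >> = f' << m >>) -> f =1 f'.
Proof.
move=> lf lf' ff' p; rewrite [p]malg_sum !lin_sum //; apply: eq_bigr => m _.
by rewrite !linZ // ff'.
Qed.

Lemma malg_bilinear_eq (V : lmodType K) (f f' : A -> A -> V) :
  bilinear_map f -> bilinear_map f' ->
  (forall m n, f << m >> << n >> = f' << m >> << n >>) -> f =2 f'.
Proof.
move=> [lf rf] [lf' rf'] ff' p q.
apply: (malg_linear_eq (rf p) (rf' p)) => n.
by apply: (malg_linear_eq (lf _) (lf' _)) => m.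
Qed.

Lemma malgUM m n : (<< m >> : A) * << n >> = << (mmul m n) >>.
Proof. by rewrite malgM_def fgmulUU mulr1. Qed.

Lemma malg_mul_bilinear : bilinear_map (fun p q : A => p * q).
Proof.
split=> [b k x y|a k x y]; first by rewrite mulrDl scalerAl.
(* M need not be commutative: scalars cross a because K is commutative. *)
rewrite mulrDr; congr (_ + _); apply/malgP => m; symmetry.
rewrite mcoeffZ mcoeffMr (mcoeffMrw _ (fsubset_refl _) (msuppZ_le _ _)).
rewrite mulr_sumr; apply: eq_bigr => w2 _; rewrite mulr_sumr.
by apply: eq_bigr => w1 _; rewrite mcoeffZ mulrCA mulrnAr.
Qed.

(** Every comultiplication and counit of this development is a linear extension
    of a multiplicative map on monomials, hence multiplicative. The product on
    the target is an arbitrary bilinear map because tensor products carry a ring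
    structure and a module structure, but a priori no algebra structure. *)
Lemma lin_ext_mul (V : lmodType K) (mulV : V -> V -> V) (H : M -> V) :
  bilinear_map mulV -> (forall m n, H (mmul m n) = mulV (H m) (H n)) ->
  forall p q, lin_ext H (p * q) = mulV (lin_ext H p) (lin_ext H q).
Proof.
move=> bV HM; apply: malg_bilinear_eq.
- exact: bilinear_lin (lin_ext_linear H) malg_mul_bilinear.
- exact: bilinear_comp (lin_ext_linear H) (lin_ext_linear H) bV.
by move=> m n; rewrite malgUM !lin_extU.
Qed.

End LinearExtension.

(** * Tensor products *)

Section Tensor.
Variables (K : comNzRingType).
Implicit Types A B V : lmodType K.

Lemma tensor_lift_tens A B V (f : A -> B -> V) a b :
  bilinear_map f -> tensor_lift f (a ⊗ b) = f a b.
Proof. by move=> bf; rewrite tensor_lift_pi // /bisum big_seq1. Qed.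

Lemma tensor_lift_linear A B V (f : A -> B -> V) :
  bilinear_map f -> linear (tensor_lift f).
Proof.
by move=> bf k x y; rewrite tensor_lift_add // tensor_lift_scale.
Qed.

Lemma tens_bilinear A B : bilinear_map (@tens K A B).
Proof.
split=> [b|a] k x y; apply: tensorP => V f bf.
  by rewrite tensor_lift_linear // !tensor_lift_tens // bf.1.
by rewrite tensor_lift_linear // !tensor_lift_tens // bf.2.
Qed.

Lemma tensor_sum A B (x : tensor A B) : x = \sum_(p <- repr x) p.1 ⊗ p.2.
Proof.
apply: tensorP => V f bf; rewrite lin_sum; last exact: tensor_lift_linear.
by apply: eq_bigr => p _; rewrite tensor_lift_tens.
Qed.

(** The recurrent proof principle for tensors: a linear identity needs to be
    checked on pure tensors only. *)
Lemma tensor_linear_eq A B V (f f' : tensor A B -> V) :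
  linear f -> linear f' -> (forall a b, f (a ⊗ b) = f' (a ⊗ b)) -> f =1 f'.
Proof.
move=> lf lf' ff' x; rewrite [x]tensor_sum !lin_sum //; exact: eq_bigr.
Qed.

Lemma tensor_map_bilinear A B A' B' (f : A -> A') (g : B -> B') :
  linear f -> linear g -> bilinear_map (fun a b => f a ⊗ g b).
Proof. by move=> lf lg; exact: bilinear_comp lf lg (tens_bilinear _ _). Qed.

Lemma tensor_map_tens A B A' B' (f : A -> A') (g : B -> B') a b :
  linear f -> linear g -> tensor_map f g (a ⊗ b) = f a ⊗ g b.
Proof. by move=> lf lg; exact: tensor_lift_tens (tensor_map_bilinear lf lg). Qed.

Lemma tensor_map_linear A B A' B' (f : A -> A') (g : B -> B') :
  linear f -> linear g -> linear (tensor_map f g).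
Proof. by move=> lf lg; exact: tensor_lift_linear (tensor_map_bilinear lf lg). Qed.

Lemma tensor_map_comp A B A' B' A'' B'' (f : A -> A') (g : B -> B')
    (f' : A' -> A'') (g' : B' -> B'') x :
  linear f -> linear g -> linear f' -> linear g' ->
  tensor_map f' g' (tensor_map f g x) = tensor_map (f' \o f) (g' \o g) x.
Proof.
move=> lf lg lf' lg'.
have l := tensor_map_linear.
apply: (tensor_linear_eq (lin_comp (l _ _ _ _ _ _ lf' lg') (l _ _ _ _ _ _ lf lg))).
  by apply: l; exact: lin_comp.
by move=> a b; rewrite /= !tensor_map_tens //; exact: lin_comp.
Qed.

Lemma tensor_map_id A B (f : A -> A) (g : B -> B) x :
  f =1 id -> g =1 id -> tensor_map f g x = x.
Proof.
move=> fid gid; rewrite [RHS]tensor_sum /tensor_map /tensor_lift /bisum.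
by apply: eq_bigr => p _; rewrite fid gid.
Qed.

Lemma tensor_lift_map A B A' B' V (f : A -> A') (g : B -> B')
    (b : A' -> B' -> V) x :
  linear f -> linear g -> bilinear_map b ->
  tensor_lift b (tensor_map f g x) = tensor_lift (fun a a' => b (f a) (g a')) x.
Proof.
move=> lf lg bb.
apply: (tensor_linear_eq (lin_comp (tensor_lift_linear bb) (tensor_map_linear lf lg))).
  exact/tensor_lift_linear/bilinear_comp.
move=> a a'; rewrite /= tensor_map_tens // !tensor_lift_tens //.
exact: bilinear_comp.
Qed.

Lemma lin_tensor_lift A B V (W : lmodType K) (f : V -> W) (b : A -> B -> V) x :
  linear f -> f (tensor_lift b x) = tensor_lift (fun a a' => f (b a a')) x.
Proof. by move=> lf; rewrite /tensor_lift /bisum lin_sum. Qed.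

Lemma tensor_assoc_inner_bilinear A B (C : lmodType K) (c : C) :
  bilinear_map (fun (a : A) (b : B) => a ⊗ (b ⊗ c)).
Proof.
split=> [b|a] k x y; first exact: (tens_bilinear _ _).1.
by rewrite (tens_bilinear _ _).1 (tens_bilinear _ _).2.
Qed.

Lemma tensor_assoc_bilinear A B (C : lmodType K) :
  bilinear_map (fun (t : tensor A B) (c : C) =>
    tensor_lift (fun a b => a ⊗ (b ⊗ c)) t).
Proof.
split=> [c|t]; first exact/tensor_lift_linear/tensor_assoc_inner_bilinear.
move=> k c c'; rewrite /tensor_lift /bisum scaler_sumr -big_split.
by apply: eq_bigr => p _; rewrite !(tens_bilinear _ _).2.
Qed.

Lemma tensor_assoc_linear A B (C : lmodType K) : linear (@tensor_assoc K A B C).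
Proof. exact/tensor_lift_linear/tensor_assoc_bilinear. Qed.

Lemma tensor_assoc_tens A B (C : lmodType K) (a : A) (b : B) (c : C) :
  tensor_assoc ((a ⊗ b) ⊗ c) = a ⊗ (b ⊗ c).
Proof.
rewrite /tensor_assoc tensor_lift_tens; last exact: tensor_assoc_bilinear.
rewrite tensor_lift_tens //; exact: tensor_assoc_inner_bilinear.
Qed.

Lemma tensor_assoc_nat A B (C : lmodType K) A' B' (C' : lmodType K)
    (f : A -> A') (g : B -> B') (k : C -> C') x :
  linear f -> linear g -> linear k ->
  tensor_assoc (tensor_map (tensor_map f g) k x) =
  tensor_map f (tensor_map g k) (tensor_assoc x).
Proof.
move=> lf lg lk; have l := tensor_map_linear; have la := tensor_assoc_linear.
have lfg := l _ _ _ _ _ _ lf lg; have lgk := l _ _ _ _ _ _ lg lk.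
apply: (tensor_linear_eq (lin_comp (@la _ _ _) (l _ _ _ _ _ _ lfg lk))
                         (lin_comp (l _ _ _ _ _ _ lf lgk) (@la _ _ _))) => t c /=.
rewrite tensor_map_tens //.
have l1 := lin_comp (@la _ _ _)
   (lin_comp ((tens_bilinear (tensor A' B') C').1 (k c)) lfg).
have l2 := lin_comp (lin_comp (l _ _ _ _ _ _ lf lgk) (@la _ _ _))
   ((tens_bilinear (tensor A B) C).1 c).
apply: (tensor_linear_eq l1 l2) => a b /=.
by rewrite !tensor_assoc_tens !tensor_map_tens // tensor_assoc_tens.
Qed.

End Tensor.

Section TensorAlgebra.
Variables (K : comNzRingType).
Implicit Types A B : algType K.

Lemma tensM A B (a a' : A) (b b' : B) :
  (a ⊗ b) * (a' ⊗ b') = (a * a') ⊗ (b * b').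
Proof.
apply: tensorP => V f bf; rewrite tensor_lift_mul //.
rewrite [LHS]tensor_lift_tens; last exact: (bilinear_liftr bf).
by rewrite !tensor_lift_tens //; exact: (bilinear_mull bf).
Qed.

Lemma tensor_mul_bilinear A B : bilinear_map (fun x y : tensor A B => x * y).
Proof.
split=> [y k x x'|x k y y'].
  rewrite mulrDl; congr (_ + _); apply: tensorP => V f bf.
  rewrite tensor_lift_mul // !tensor_lift_scale //; last exact: (bilinear_liftr bf).
  by rewrite tensor_lift_mul.
rewrite mulrDr; congr (_ + _); apply: tensorP => V f bf.
rewrite tensor_lift_mulC // !tensor_lift_scale //; last exact: (bilinear_liftl bf).
by rewrite tensor_lift_mulC.
Qed.

Lemma tensor_map_mul A B A' B' (f : A -> A') (g : B -> B') :
  linear f -> linear g -> {morph f : x y / x * y} -> {morph g : x y / x * y} ->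
  {morph tensor_map f g : x y / x * y}.
Proof.
move=> lf lg fM gM x y; have l := tensor_map_linear lf lg.
have bM := tensor_mul_bilinear.
have b1 := bilinear_lin l (bM A B); have b2 := bilinear_comp l l (bM A' B').
apply: (tensor_linear_eq (b1.1 y) (b2.1 y)) => a b.
apply: (tensor_linear_eq (b1.2 _) (b2.2 _)) => a' b'.
by rewrite tensM !tensor_map_tens // tensM fM gM.
Qed.

Lemma tensor_mulC (A B : comAlgType K) (x y : tensor A B) : x * y = y * x.
Proof.
have bM := tensor_mul_bilinear A B.
apply: (tensor_linear_eq (bM.1 y) (bM.2 y)) => a b.
apply: (tensor_linear_eq (bM.2 _) (bM.1 _)) => a' b'.
by rewrite !tensM [a * _]mulrC [b * _]mulrC.
Qed.

End TensorAlgebra.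

(** * Iterated commutators *)
Lemma commutatorE (R : pzRingType) (x y : R) : x * y = y * x + commutator x y.
Proof. by rewrite /commutator addrC subrK. Qed.

(** For x = g and y = h this is the bracket of the Lyndon word g h^k. *)
Definition iter_ad (R : pzRingType) (x y : R) k : R :=
  iter k (fun a => commutator a y) x.

Lemma iter_ad_morph (R S : pzRingType) (f : R -> S) x y k :
  {morph f : a b / a - b} -> {morph f : a b / a * b} ->
  f (iter_ad x y k) = iter_ad (f x) (f y) k.
Proof.
move=> fB fM; elim: k => // k IHk.
rewrite [iter_ad _ _ _]/(commutator (iter_ad x y k) y).
by rewrite [RHS]/(commutator (iter_ad (f x) (f y) k) (f y)) -IHk /commutator fB !fM.
Qed.

(** * Lyndon words and the ideal they generate *)

Lemma lyndon_rot (w : word) i :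
  lyndon w -> (0 < i < size w)%N -> (w < (rot i w : word))%O.
Proof.
case/andP=> _ /allP lw /andP[i0 iw]; apply: lw.
by rewrite mem_iota i0 add1n prednK //; apply: leq_ltn_trans iw.
Qed.

Lemma lyndonP (w : word) : w != [::] ->
  (forall i, (0 < i < size w)%N -> (w < (rot i w : word))%O) -> lyndon w.
Proof.
move=> w0 lw; rewrite /lyndon w0; apply/allP => i; rewrite mem_iota add1n.
by rewrite prednK; [apply: lw|rewrite lt0n size_eq0].
Qed.

Lemma ltxi_gh (v w : seq bool) : ((g :: v : word) < (h :: w : word))%O.
Proof. by rewrite Order.SeqLexiOrder.ltxi_cons. Qed.

Lemma ltxi_hg (v w : seq bool) : ((h :: v : word) < (g :: w : word))%O = false.
Proof. by rewrite Order.SeqLexiOrder.ltxi_cons. Qed.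

Lemma lyndon_head (v : word) : lyndon (h :: v) -> g \notin v.
Proof.
move=> lw; apply/negP => gv.
have := lyndon_rot lw (_ : (0 < (index g v).+1 < size (h :: v))%N).
rewrite /= ltnS index_mem gv => /(_ isT).
by rewrite /rot /= (drop_nth h) ?index_mem // nth_index // ltxi_hg.
Qed.

Lemma count0_nseq (v : seq bool) : count_mem g v = 0%N -> v = nseq (size v) h.
Proof.
by move/eqP; rewrite -leqn0 leqNgt -has_count => gv; apply/all_pred1P;
  move: gv; rewrite -all_predC; apply: sub_all => -[].
Qed.

Lemma lyndon_count0 (w : word) : lyndon w -> count_mem g w = 0%N -> w = [:: h].
Proof.
move=> lw /count0_nseq w_h; have: w != [::] by case/andP: lw.
case: (size w) w_h lw => [->//|[->//|n]] -> lw _.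
have := lyndon_rot lw (_ : 0 < 1 < _)%N; rewrite size_nseq => /(_ isT).
by rewrite rot1_cons -cats1 -(nseqD n.+1 1) addn1 ltxx.
Qed.

(** Together with [lyndon_count0] this lists all Lyndon words with at most one g:
    such a word starts with its smallest letter, g, so it is g h^k, or it is h. *)
Lemma lyndon_count1 (w : word) :
  lyndon w -> count_mem g w = 1%N -> w = omega (size w).-1.
Proof.
case: w => [//|[] v] lw /=; last by rewrite add1n => -[/count0_nseq {1}->].
rewrite add0n => /eqP; rewrite eqn_leq -has_count has_pred1.
by rewrite (negPf (lyndon_head lw)) andbF.
Qed.

Lemma lyndon_omega k : lyndon (omega k).
Proof.
apply: lyndonP => // -[//|i]; rewrite /= size_nseq ltnS => ik.
rewrite /rot /= drop_nseq.
by case: (k - i)%N (subn_gt0 i k) => [|n]; rewrite ik // ltxi_gh.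
Qed.

Lemma lyndon_nseqh k : lyndon (nseq k h) = (k == 1%N).
Proof.
apply/idP/eqP => [lw|->//].
have : nseq k h = [:: h] by apply: lyndon_count0; rewrite // count_nseq.
by move/(congr1 size); rewrite size_nseq.
Qed.

Lemma std_cutP (w : word) : std_cut w = 0%N \/
  [/\ (0 < std_cut w < size w)%N, lyndon (take (std_cut w) w)
    & lyndon (drop (std_cut w) w)].
Proof.
case s_cut: [seq i <- iota 1 (size w).-1 | lyndon (take i w) && lyndon (drop i w)]
  => [|c s]; [by left; rewrite /std_cut s_cut|right].
have -> : std_cut w = c by rewrite /std_cut s_cut.
have := mem_head c s; rewrite -s_cut mem_filter mem_iota add1n.
case/andP=> /andP[lt ld] /andP[c0 cw]; split; rewrite ?c0 //=.
by case: (size w) cw => [|//]; case: (c) c0.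
Qed.

(** A cut is standard as soon as every earlier one leaves a suffix that is not
    Lyndon: the standard cut is the first one with two Lyndon halves. *)
Lemma std_cut_first (w : word) c :
  (0 < c < size w)%N -> lyndon (take c w) -> lyndon (drop c w) ->
  (forall i, (0 < i < c)%N -> ~~ lyndon (drop i w)) -> std_cut w = c.
Proof.
case/andP=> c0 cw lt ld cmin; rewrite /std_cut.
have -> : (size w).-1 = (c.-1 + ((size w).-1 - c).+1)%N.
  case: c c0 cw {lt ld cmin} => // c _ /=; case: (size w) => //= n.
  by rewrite ltnS => cn; rewrite addnS -addSn subnKC.
rewrite iotaD filter_cat (_ : filter _ (iota 1 c.-1) = [::]).
  by rewrite /= add1n prednK // lt ld.
apply/eqP; rewrite -[_ == _]negbK -has_filter; apply/hasPn => i.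
by rewrite mem_iota add1n prednK // => /cmin/negPf->; rewrite andbF.
Qed.

Lemma std_cut_omega k : std_cut (omega k.+1) = k.+1.
Proof.
apply: std_cut_first => [||| [//|i]].
- by rewrite /= size_nseq ltnSn.
- by rewrite -[take _ _]/(g :: take k (nseq k.+1 h)) take_nseq ?lyndon_omega // leqnSn.
- by rewrite -[drop _ _]/(drop k (nseq k.+1 h)) drop_nseq subSnn.
rewrite -[drop _ _]/(drop i (nseq k.+1 h)) drop_nseq lyndon_nseqh /= ltnS => ik.
by rewrite subSn ?(ltnW ik) // eqSS subn_eq0 -ltnNge.
Qed.

Lemma std_cut_omega2 i j : (i < j)%N -> std_cut (omega i ++ omega j) = i.+1.
Proof.
have si : size (omega i) = i.+1 by rewrite /= size_nseq.
move=> ij; apply: std_cut_first; rewrite ?size_cat ?si.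
- by rewrite /= addnS ltnS leq_addr.
- by rewrite take_size_cat // lyndon_omega.
- by rewrite drop_size_cat // lyndon_omega.
case=> [//|k]; rewrite /= ltnS => ki.
rewrite drop_cat size_nseq ki drop_nseq.
have := subn_gt0 k i; rewrite ki; case: (i - k)%N => // n _.
by apply/negP => /lyndon_head; rewrite mem_cat inE eqxx orbT.
Qed.

(** For i < j the word g h^i g h^j is Lyndon, and its standard factorization is
    the visible one. This is how the commutators of the iterated brackets
    become generators of the ideal. *)
Lemma lyndon_omega2 i j : (i < j)%N -> lyndon (omega i ++ omega j).
Proof.
have si : size (omega i) = i.+1 by rewrite /= size_nseq.
have cmp a b (v w : seq bool) : (a < b)%N ->
    ((nseq a h ++ g :: v : word) < (nseq b h ++ w : word))%O.
  elim: a b => [|a IHa] [//|b] ab; first exact: ltxi_gh.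
  by rewrite /= Order.SeqLexiOrder.ltxi_cons lexx /=; apply: IHa.
move=> ij; apply: lyndonP => // -[//|k].
rewrite size_cat si addSn !ltnS leq0n andTb => kw.
case: (ltngtP k i) => [ki|ik|->].
- rewrite /rot /= drop_cat size_nseq ki drop_nseq.
  by have := subn_gt0 k i; rewrite ki; case: (i - k)%N => // n _; apply: ltxi_gh.
- rewrite /rot drop_cat si ltnS ltnNge (ltnW ik) subSS.
  have := subn_gt0 i k; rewrite ik; case kE: (k - i)%N => [//|n] _ /=.
  rewrite drop_nseq; have: (n < j)%N.
    by rewrite -ltnS -kE ltn_subLR ?(ltnW ik) // (leq_trans kw) //= size_nseq.
  by rewrite -subn_gt0; case: (j - n)%N => // p _; apply: ltxi_gh.
have := rot_size_cat (omega i) (omega j); rewrite si => ->.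
by rewrite /= Order.SeqLexiOrder.ltxi_cons lexx /=; apply: cmp.
Qed.

Section Ideal.
Variable K : fieldType.
Local Notation T := (free_alg K).

Local Notation ad_h := (iter_ad (letter K g) (letter K h)).

(** The fuel of the bracket only has to exceed the length of the word, so the
    lemmas below are stated for every sufficient amount. *)
Lemma bracket_step n (w : word) : (1 < size w)%N ->
  lyndon_bracket_rec K n.+1 w = commutator
    (lyndon_bracket_rec K n (take (std_cut w) w))
    (lyndon_bracket_rec K n (drop (std_cut w) w)).
Proof. by case: w => [|a [|b w]]. Qed.

Lemma bracket_omega n k : (k < n)%N -> lyndon_bracket_rec K n (omega k) = ad_h k.
Proof.
elim: k n => [|k IHk] n; first by case: n.
case: n => [|n]; first by rewrite ltn0.
rewrite ltnS => kn; rewrite bracket_step; last by rewrite /= size_nseq.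
rewrite std_cut_omega -[take _ _]/(g :: take k (nseq k.+1 h)).
rewrite take_nseq; last exact: leqnSn.
rewrite -[drop _ _]/(drop k (nseq k.+1 h)) drop_nseq subSnn.
rewrite -[g :: _]/(omega k) (IHk _ kn) (_ : lyndon_bracket_rec K n _ = letter K h).
  by [].
by case: (n) kn.
Qed.

Lemma E_omega k : E K (omega k) = ad_h k.
Proof. by apply: bracket_omega; rewrite /= size_nseq. Qed.

Lemma E_omega2 i j : (i < j)%N ->
  E K (omega i ++ omega j) = commutator (ad_h i) (ad_h j).
Proof.
move=> ij; have si : size (omega i) = i.+1 by rewrite /= size_nseq.
rewrite /E size_cat si addSn bracket_step; last first.
  by rewrite size_cat si /= addnS.
rewrite (std_cut_omega2 ij).
rewrite (take_size_cat _ si) (drop_size_cat _ si) !bracket_omega; first by [].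
  by rewrite /= size_nseq addnS ltnS leq_addl.
by rewrite /= size_nseq addnS ltnS leq_addr.
Qed.

Lemma I_set_commutator i j : I_set (commutator (ad_h i) (ad_h j)).
Proof.
have [_ _ IM] := smallest_two_sided_ideal (@ideal_generators K).
have gen i' j' : (i' < j')%N -> I_set (commutator (ad_h i') (ad_h j')).
  move=> ij; apply: sub_gen_smallest; rewrite -(E_omega2 ij).
  exists (omega i' ++ omega j'); last by [].
  split; first exact: lyndon_omega2.
  by rewrite count_cat /= !add1n addSn addnS.
have [ij|ji|->] := ltngtP i j; first exact: gen.
  by have := IM (-1) 1 _ (gen _ _ ji); rewrite mulr1 mulN1r opprB.
by rewrite /commutator subrr; case: (smallest_two_sided_ideal (@ideal_generators K)).
Qed.

Section Sub.
Variable J : set T.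
Hypotheses (idJ : two_sided_ideal J)
  (J_comm : forall i j, J (commutator (ad_h i) (ad_h j))).

Lemma ideal_commutator a b : J a \/ J b -> J (commutator a b).
Proof.
case: idJ => _ JD JM [Ja|Jb].
  have := JD _ _ (JM 1 b _ Ja) (JM (- b) 1 _ Ja).
  by rewrite mul1r mulr1 mulNr.
have := JD _ _ (JM a 1 _ Jb) (JM (- 1) a _ Jb).
by rewrite mulr1 !mulN1r mulNr.
Qed.

(** The standard factors of a Lyndon word with at least two g either contain
    one with at least two g, to which induction applies, or both have exactly
    one g, and then the bracket is a commutator of iterated brackets. *)
Lemma bracket_in_ideal n w :
  (size w <= n)%N -> lyndon w -> (2 <= count_mem g w)%N ->
  J (lyndon_bracket_rec K n w).
Proof.
elim: n w => [|n IHn] w; first by case: w.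
move=> wn lw gw; rewrite bracket_step; last exact: leq_trans gw (count_size _ _).
have [->|[/andP[c0 cw] lt ld]] := std_cutP w.
  (* Without a standard cut the left half is empty, and its bracket is 0. *)
  rewrite take0 (_ : lyndon_bracket_rec K n [::] = 0); last first.
    by case: (n) => [|n'] //=; rewrite /commutator subrr.
  by rewrite /commutator mul0r mulr0 subrr; case: idJ.
have st : (size (take (std_cut w) w) <= n)%N.
  by rewrite size_takel ?(ltnW cw) // -ltnS (leq_trans cw).
have sd : (size (drop (std_cut w) w) <= n)%N.
  by rewrite size_drop leq_subLR (leq_trans wn) // -add1n leq_add2r.
move: gw; rewrite -{1}(cat_take_drop (std_cut w) w) count_cat.
move: (take _ w) (drop _ w) lt ld st sd => x y lx ly sx sy.
case cx: (count_mem g x) => [|[|p]].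
- by move=> cy; apply: ideal_commutator; right; apply: IHn.
- case cy: (count_mem g y) => [|[|q]] // _.
    move: sx sy; rewrite (lyndon_count1 lx cx) (lyndon_count1 ly cy) /= !size_nseq.
    by move=> sx sy; rewrite (bracket_omega sx) (bracket_omega sy).
  by apply: ideal_commutator; right; apply: IHn; rewrite ?cy.
by move=> _; apply: ideal_commutator; left; apply: IHn; rewrite ?cx.
Qed.

(** With [I_set_commutator]: the ideal is the one generated by the commutators
    of the iterated brackets. Every passage to the quotient rests on this. *)
Lemma I_set_sub : @I_set K `<=` J.
Proof. by move=> x; apply; split=> // _ [w [lw gw] <-]; apply: bracket_in_ideal. Qed.

End Sub.

Lemma I_set_kernel (S : pzRingType) (f : T -> S) :
  {morph f : x y / x - y} -> {morph f : x y / x * y} ->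
  (forall i j, f (ad_h i) * f (ad_h j) = f (ad_h j) * f (ad_h i)) ->
  forall x, I_set x -> f x = 0.
Proof.
move=> fB fM fC.
have f0 : f 0 = 0 by rewrite -(subrr 0) fB subrr.
have fN x : f (- x) = - f x by rewrite -[- x]add0r fB f0 add0r.
apply: I_set_sub => [|i j]; last by rewrite /commutator fB !fM fC subrr.
split=> [//|x y fx fy|a b x fx]; last by rewrite !fM fx mulr0 mul0r.
by rewrite -[y]opprK fB fN fx fy oppr0 subr0.
Qed.

End Ideal.

(** * Coefficients of the partial Bell polynomials *)

Section Weight.
Implicit Types m : {cmonom nat}.

Lemma big_finsupp (R : Type) (idx : R) (op : Monoid.com_law idx) m N (F : nat -> R) :
  (forall j, m j = 0%N -> F j = idx) -> (forall j, (N <= j)%N -> m j = 0%N) ->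
  \big[op/idx]_(j <- finsupp m) F j = \big[op/idx]_(j < N) F j.
Proof.
move=> F0 mN; rewrite -(big_mkord xpredT F) /index_iota subn0.
rewrite [RHS](bigID (mem (finsupp m))) /= [X in _ = op _ X]big1 ?Monoid.mulm1.
  rewrite -[RHS]big_filter; apply: perm_big; apply: uniq_perm.
  - exact: fset_uniq.
  - by rewrite filter_uniq ?iota_uniq.
  move=> j; rewrite mem_filter mem_iota /= add0n; case: finsuppP => //= jm.
  by rewrite ltnNge; apply/esym/negP => /mN; apply/eqP; rewrite cmE_neq0.
by move=> j; rewrite -cmE_eq0 => /eqP/F0.
Qed.

Lemma finsupp_bound m : {N | forall j, (N <= j)%N -> m j = 0%N}.
Proof.
exists (\max_(j <- finsupp m) j.+1) => j; apply: contraTeq; rewrite cmE_neq0 -ltnNge.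
by move=> jm; rewrite (big_rem j) //= leq_max leqnn.
Qed.

Definition weight m : nat := (\sum_(j <- finsupp m) j.+1 * m j)%N.
(** The denominator of the coefficient of the monomial m in a Bell polynomial. *)
Definition bell_denom m : nat := (\prod_(j <- finsupp m) ((m j)`! * j.+1`! ^ m j))%N.

Lemma weightE m N : (forall j, (N <= j)%N -> m j = 0%N) ->
  weight m = (\sum_(j < N) j.+1 * m j)%N.
Proof. by move=> mN; apply: big_finsupp => // j ->; rewrite muln0. Qed.

Lemma bell_denomE m N : (forall j, (N <= j)%N -> m j = 0%N) ->
  bell_denom m = (\prod_(j < N) ((m j)`! * j.+1`! ^ m j))%N.
Proof. by move=> mN; apply: big_finsupp => // j ->. Qed.

Lemma mdegEN m N : (forall j, (N <= j)%N -> m j = 0%N) ->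
  mdeg m = (\sum_(j < N) m j)%N.
Proof. by move=> mN; apply: big_finsupp. Qed.

Lemma bell_denom_gt0 m : (0 < bell_denom m)%N.
Proof. by apply: prodn_gt0 => j; rewrite muln_gt0 fact_gt0 expn_gt0 fact_gt0. Qed.

Lemma leq_weight m j : (j.+1 * m j <= weight m)%N.
Proof.
case: (finsupp_bound m) => N mN; rewrite (weightE mN).
case: (ltnP j N) => jN; last by rewrite mN // muln0.
by rewrite (bigD1 (Ordinal jN)) //= leq_addr.
Qed.

Lemma weight_bound m j : (weight m <= j)%N -> m j = 0%N.
Proof. by move=> mj; have := leq_weight m j; case: (m j) => // a; nia. Qed.

Lemma mdeg_leq_weight m : (mdeg m <= weight m)%N.
Proof.
rewrite (mdegEN (@weight_bound m)) [leqRHS](weightE (@weight_bound m)).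
by apply: leq_sum => j _; rewrite leq_pmull.
Qed.

Lemma mulU_bound m i N : (forall j, (N <= j)%N -> mmul (ucm i) m j = 0%N) ->
  (i < N)%N /\ (forall j, (N <= j)%N -> m j = 0%N).
Proof.
move=> mN; split=> [|j /mN]; last by rewrite cmM; lia.
by rewrite ltnNge; apply/negP => /mN; rewrite cmM cmU eqxx.
Qed.

Lemma weight_mulU m i : weight (mmul (ucm i) m) = (i.+1 + weight m)%N.
Proof.
case: (finsupp_bound (mmul (ucm i) m)) => N mN.
have [iN mN'] := mulU_bound mN.
rewrite (weightE mN) (weightE mN').
rewrite (bigD1 (Ordinal iN)) //= [in RHS](bigD1 (Ordinal iN)) //=.
rewrite cmM cmU eqxx mulnDr muln1 -addnA; congr (_ + (_ + _))%N.
apply: eq_bigr => j ji; rewrite cmM cmU; case: eqP => // ij.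
by case/eqP: ji; apply: val_inj.
Qed.

Lemma bell_denom_mulU m i :
  bell_denom (mmul (ucm i) m) = (bell_denom m * ((m i).+1 * i.+1`!))%N.
Proof.
case: (finsupp_bound (mmul (ucm i) m)) => N mN.
have [iN mN'] := mulU_bound mN.
rewrite (bell_denomE mN) (bell_denomE mN').
rewrite (bigD1 (Ordinal iN)) //= [in RHS](bigD1 (Ordinal iN)) //=.
rewrite cmM cmU eqxx add1n factS expnS [RHS]mulnAC; congr (_ * _)%N.
  by rewrite mulnACA mulnC.
apply: eq_bigr => j ji; rewrite cmM cmU; case: eqP => // ij.
by case/eqP: ji; apply: val_inj.
Qed.

(** The type of i makes an ordinal index be read as its value. *)
Definition remU m (i : nat) : {cmonom nat} := divcm m (ucm i).

Lemma remUE m i j : remU m i j = (m j - (i == j))%N.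
Proof. by rewrite divcmE cmU. Qed.

Lemma divU m i : m i != 0%N -> mmul (ucm i) (remU m i) = m.
Proof.
move=> mi; apply/eqP/cmP => j; rewrite cmM remUE cmU.
by case: eqP => [<-|_]; lia.
Qed.

(** Write c(m) for the factorial of the weight of m over its denominator. In
    weight n + 1 we have c(m) = sum_i binomial(n, i) c(m / u_i): each summand,
    multiplied by the denominator of m, is n! (i + 1) m_i, and these add up to
    n! times the weight. The same identity proves that the quotients are exact,
    which is why divisibility in lower weight is a hypothesis. *)
Lemma bell_coef_sum n m : weight m = n.+1 ->
  (forall m', (weight m' <= n)%N -> bell_denom m' %| (weight m')`!)%N ->
  (bell_denom m * \sum_(i < n.+1 | m i != 0)
     'C(n, i) * ((n - i)`! %/ bell_denom (remU m i)) = n.+1`!)%N.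
Proof.
move=> wm dvd; rewrite factS -[X in _ = (X * _)%N]wm (@weightE m n.+1); last first.
  by move=> j nj; apply: weight_bound; rewrite wm.
rewrite big_distrr big_distrl /= big_mkcond; apply: eq_bigr => -[i /= ni] _.
case: eqP => [->|/eqP mi] /=; first by rewrite muln0.
have mE := divU mi; set m' := remU m _ in mE *.
have wm' : weight m' = (n - i)%N by move: wm; rewrite -mE weight_mulU; lia.
have := dvd m' (_ : _ <= n)%N; rewrite wm' leq_subr => /(_ isT)/divnK.
set q := (_ %/ _)%N => qE; have bE := bell_denom_mulU m' i; rewrite mE in bE.
have -> : m i = (m' i).+1 by rewrite -mE cmM cmU eqxx.
have le_in : (i <= n)%N by rewrite -ltnS.
rewrite -(bin_fact le_in) -qE bE factS.
move: {qE}q (bell_denom m') (m' i).+1 i`! 'C(n, i) (i.+1) => p b a f c s; lia.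
Qed.

Lemma bell_denom_dvd m : (bell_denom m %| (weight m)`!)%N.
Proof.
have [n] := ubnP (weight m); elim: n m => // n IHn m; rewrite ltnS.
case wm: (weight m) => [|k] kn.
  rewrite (bell_denomE (N := 0)) ?big_ord0 // => j _; apply: weight_bound; lia.
rewrite -(bell_coef_sum wm) ?dvdn_mulr // => m' m'k; apply: IHn; lia.
Qed.

End Weight.

Section Bell.
Variable K : fieldType.
Local Notation B := (FdB K).
Implicit Types m : {cmonom nat}.

Definition ucme i e : {cmonom nat} := iter e (mmul (ucm i)) mone.

Lemma ucmeE i e j : ucme i e j = ((i == j) * e)%N.
Proof.
elim: e => [|e IHe]; first by rewrite cm1 muln0.
by rewrite /ucme iterS cmM -/(ucme i e) IHe cmU mulnS.
Qed.

Lemma u_exp i e : u K i ^+ e = << ucme i e >>.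
Proof.
elim: e => [|e IHe]; first by rewrite expr0.
by rewrite exprS IHe /ucme iterS; apply: malgUM.
Qed.

Definition mon n (f : 'I_n -> nat) : {cmonom nat} :=
  \big[mmul/mone]_(j < n) ucme j (f j).

Lemma monE n (f : 'I_n -> nat) i :
  mon f i = (\sum_(j < n) (val j == i) * f j)%N.
Proof.
rewrite /mon (big_morph (fun m => m i) (id1 := 0%N) (op1 := addn)) ?cm1 //.
  by apply: eq_bigr => j _; rewrite ucmeE.
by move=> m m'; rewrite cmM.
Qed.

Lemma mon_out n (f : 'I_n -> nat) j : (n <= j)%N -> mon f j = 0%N.
Proof.
move=> nj; rewrite monE big1 // => i _; case: eqP => // ij.
by have := ltn_ord i; rewrite [X in (X < _)%N]ij ltnNge nj.
Qed.

Lemma mon_in n (f : 'I_n -> nat) (j : 'I_n) : mon f j = f j.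
Proof.
rewrite monE (bigD1 j) //= eqxx mul1n big1 ?addn0 // => i /negPf ij.
by rewrite val_eqE ij.
Qed.

Lemma prod_u n (f : 'I_n -> nat) : \prod_(j < n) u K j ^+ f j = << mon f >>.
Proof.
rewrite /mon; elim/big_rec2: _ => [|j m p _ ->]; first exact: erefl.
rewrite u_exp; exact: malgUM.
Qed.

Lemma mon_inj n (f f' : {ffun 'I_n -> 'I_n.+1}) :
  mon (fun j => f j) = mon (fun j => f' j) -> f = f'.
Proof.
move=> ff'; apply/ffunP => j; apply: val_inj.
by have := congr1 (fun m : {cmonom nat} => m (val j)) ff'; rewrite /= !mon_in.
Qed.

(** The sum defining [bell] runs over bounded exponent vectors; a monomial of
    weight n comes from exactly one of them. *)
Lemma bell_coef n k m : (bell K n k)@_m =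
  (if (mdeg m == k) && (weight m == n) then (n`! %/ bell_denom m)%N%:R else 0).
Proof.
rewrite /bell raddf_sum /=.
pose c : K :=
  if (mdeg m == k) && (weight m == n) then (n`! %/ bell_denom m)%N%:R else 0.
rewrite big_mkcond /= (eq_bigr (fun f : {ffun 'I_n -> 'I_n.+1} =>
  if mon (fun j => f j) == m then c else 0)); last first.
  move=> f _; rewrite prod_u /c; set mf := mon _.
  have mfN := @mon_out n (fun j => f j); rewrite -/mf in mfN.
  have mfE (j : 'I_n) : mf j = f j by exact: mon_in.
  have -> : (\sum_j f j)%N = mdeg mf.
    by rewrite (mdegEN mfN); apply: eq_bigr => j _.
  have -> : (\sum_(j < n) j.+1 * f j)%N = weight mf.
    by rewrite (weightE mfN); apply: eq_bigr => j _; rewrite mfE.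
  have -> : (\prod_(j < n) ((f j)`! * j.+1`! ^ f j))%N = bell_denom mf.
    by rewrite (bell_denomE mfN); apply: eq_bigr => j _; rewrite mfE.
  have mcf : ((n`! %/ bell_denom mf)%:R *: (<< mf >> : B))@_m =
      (n`! %/ bell_denom mf)%:R *+ (mf == m).
    by rewrite mcoeffZ mcoeffU mulrnAr mulr1.
  case: ifP => mfk; rewrite ?mcf ?mulrb; case: eqP => [<-|_]; rewrite ?mfk //.
rewrite -big_mkcond -/c.
have [cm|/negbTE cm] := boolP ((mdeg m == k) && (weight m == n)); last first.
  by rewrite /c cm big1.
have wm : weight m = n by case/andP: cm => _ /eqP.
pose f0 : {ffun 'I_n -> 'I_n.+1} := [ffun j : 'I_n => inord (m j)].
have f0m : mon (fun j => f0 j) = m.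
  apply/eqP/cmP => j; case: (ltnP j n) => jn.
    rewrite (mon_in _ (Ordinal jn)) ffunE inordK //=.
    by rewrite ltnS -wm; apply: leq_trans (leq_weight m j); apply: leq_pmull.
  by rewrite mon_out // weight_bound // wm.
rewrite (bigD1 f0) ?f0m //= big1 ?addr0 // => f /andP[/eqP fm /eqP []].
by apply: mon_inj; rewrite fm.
Qed.

Lemma mcoeff_uM i (p : B) m :
  (u K i * p)@_m = if m i == 0%N then 0 else p@_(remU m i).
Proof.
have bl : (u K i * p)@_m = \sum_(k <- msupp p) p@_k *+ (mmul (ucm i) k == m).
  rewrite malgM_def fgmulUg raddf_sum /=.
  by apply: eq_bigr => k _; rewrite mcoeffU mul1r.
rewrite bl; case: eqP => [mi|/eqP mi].
  rewrite big1 // => k _; case: eqP => // km.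
  by move: mi; rewrite -km cmM cmU eqxx.
rewrite [in RHS](monalgE p) raddf_sum /=; apply: eq_bigr => k _; rewrite mcoeffU.
congr (_ *+ _); congr nat_of_bool; rewrite -{1}(divU mi).
apply/eqP/eqP => [/eqP/cmP e|->]; last exact: erefl.
by apply/eqP/cmP => j; have := e j; rewrite !cmM => /addnI.
Qed.

(** Read combinatorially: the block that contains the last of n + 1 points has
    i other elements. *)
Lemma bell_rec n k :
  bell K n.+1 k.+1 = \sum_(i < n.+1) 'C(n, i)%:R *: (u K i * bell K (n - i) k).
Proof.
apply/malgP => m; rewrite bell_coef raddf_sum /=.
transitivity (\sum_(i < n.+1 | m i != 0%N)
    (if (mdeg m == k.+1) && (weight m == n.+1)
     then ('C(n, i) * ((n - i)`! %/ bell_denom (remU m i)))%N%:R else 0 : K)).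
  case: ifP => [/andP[_ /eqP wm]|_]; last by rewrite big1.
  rewrite -natr_sum; congr _%:R.
  have := bell_coef_sum wm (fun m' _ => bell_denom_dvd m').
  by move=> <-; rewrite mulKn // bell_denom_gt0.
rewrite big_mkcond; apply: eq_bigr => -[i /= ni] _.
rewrite mcoeffZ mcoeff_uM; case: eqP => [|/eqP mi] /=; first by rewrite mulr0.
rewrite bell_coef; have {1 2}<- := divU mi; rewrite weight_mulU mdegM mdegU.
set m' := remU m _; rewrite add1n eqSS.
have -> : (i.+1 + weight m' == n.+1)%N = (weight m' == n - i)%N by apply/eqP/eqP; lia.
by case: ifP; rewrite ?mulr0 // natrM.
Qed.

Lemma bell0 n : bell K n 0 = (n == 0%N)%:R.
Proof.
apply/malgP => m; rewrite bell_coef.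
rewrite -[RHS]/((n == 0%N)%:R@_m) -mpolyC_nat mcoeffC.
have w1 : weight mone = 0%N by rewrite /weight mdom1 big_seq_fset0.
have b1 : bell_denom mone = 1%N by rewrite /bell_denom mdom1 big_seq_fset0.
rewrite mdeg_eq0; case: (m =P mone) => [->|_] //=; rewrite ?mulr0n // w1 b1.
rewrite mulr1n eq_sym.
by case: eqP => [->|].
Qed.

Lemma bell_out n k : (n < k)%N -> bell K n k = 0.
Proof.
move=> nk; apply/malgP => m; rewrite bell_coef mcoeff0.
case: ifP => // /andP[/eqP mk /eqP mn].
by have := mdeg_leq_weight m; lia.
Qed.

End Bell.

(** * Monomials in commuting elements *)

Section Evaluation.
Variables (S : pzRingType) (v : nat -> S).
Hypothesis vC : forall i j, v i * v j = v j * v i.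
Implicit Types m n : {cmonom nat}.

Definition ev m : S := \prod_(j <- finsupp m) v j ^+ m j.

(** The support of a monomial is enumerated in an unspecified order, and the
    targets of interest (a quotient of a free algebra, a tensor product) are
    not known to be commutative rings. *)
Lemma perm_prod_comm (F : nat -> S) s t :
  (forall i j, F i * F j = F j * F i) -> perm_eq s t ->
  \prod_(i <- s) F i = \prod_(i <- t) F i.
Proof.
move=> FC; elim: s t => [|x s IHs] t st.
  by rewrite perm_sym in st; rewrite (perm_nilP st).
have xt : x \in t by rewrite -(perm_mem st) mem_head.
case/splitPr: xt st => t1 t2; rewrite perm_sym perm_catC /= perm_cons => st.
rewrite big_cons (IHs (t1 ++ t2)); last first.
  by rewrite perm_sym perm_catC.
rewrite !big_cat big_cons /= [LHS]mulrA [RHS]mulrA; congr (_ * _).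
by apply: commr_prod => i _; apply: FC.
Qed.

Lemma vXC i j a b : v i ^+ a * v j ^+ b = v j ^+ b * v i ^+ a.
Proof. by apply: commrX; apply/commr_sym/commrX/vC. Qed.

Lemma evE m (d : seq nat) : uniq d -> {subset finsupp m <= d} ->
  ev m = \prod_(j <- d) v j ^+ m j.
Proof.
move=> d_uniq md.
rewrite [RHS](eq_bigr (fun j => if j \in finsupp m then v j ^+ m j else 1)).
  rewrite -big_mkcond -big_filter; apply: perm_prod_comm => [i j|]; first exact: vXC.
  apply: uniq_perm; rewrite ?filter_uniq ?fset_uniq // => j.
  by rewrite mem_filter; case jm: (j \in finsupp m) => //=; rewrite md.
by move=> j _; case: finsuppP.
Qed.

Lemma ev1 : ev mone = 1.
Proof. by rewrite /ev mdom1 big_seq_fset0. Qed.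

Lemma evU i : ev (ucm i) = v i.
Proof. by rewrite /ev mdomU big_seq_fset1 cmUU. Qed.

Lemma evM m n : ev (mmul m n) = ev m * ev n.
Proof.
pose d := finsupp (mmul m n).
have dE j : (j \in d) = (j \in finsupp m) || (j \in finsupp n).
  by rewrite /d mdomD in_fsetU.
rewrite (@evE m d) ?(@evE n d) ?fset_uniq //; first last.
- by move=> j jm; rewrite dE jm.
- by move=> j jm; rewrite dE jm orbT.
rewrite /ev -/d -prodrM_comm => [|i j _ _]; last exact: vXC.
by apply: eq_bigr => j _; rewrite cmM exprD.
Qed.

End Evaluation.

(** * The derivation that shifts the variables *)

Section Derivation.
Variables (K : fieldType) (R : comAlgType K) (v : nat -> R).
Implicit Types m n : {cmonom nat}.
Let vC i j : v i * v j = v j * v i. Proof. exact: mulrC. Qed.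

(** The value on the monomial m of the derivation sending v_j to v_(j+1). *)
Definition shift_ev m : R :=
  \sum_(j <- finsupp m) (m j)%:R *: (ev v (remU m j) * v j.+1).

Lemma shift_evE m N : (forall j, (N <= j)%N -> m j = 0%N) ->
  shift_ev m = \sum_(j < N) (m j)%:R *: (ev v (remU m j) * v j.+1).
Proof. by move=> mN; apply: big_finsupp => // j ->; rewrite scale0r. Qed.

Lemma scale_ev_remU m n j (p : R) :
  (m j)%:R *: (ev v (remU (mmul m n) j) * p) =
  (m j)%:R *: (ev v (remU m j) * p) * ev v n.
Proof.
case: (eqVneq (m j) 0%N) => [->|mj]; first by rewrite !scale0r mul0r.
rewrite -scalerAl mulrAC -evM //; congr (_ *: (ev v _ * _)).
by apply/eqP/cmP => i; rewrite cmM !remUE cmM; case: eqP => [<-|_]; lia.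
Qed.

Lemma shift_evM m n :
  shift_ev (mmul m n) = shift_ev m * ev v n + ev v m * shift_ev n.
Proof.
case: (finsupp_bound (mmul m n)) => N mnN.
have mN j : (N <= j)%N -> m j = 0%N by move/mnN; rewrite cmM; lia.
have nN j : (N <= j)%N -> n j = 0%N by move/mnN; rewrite cmM; lia.
rewrite (shift_evE mnN) (shift_evE mN) (shift_evE nN).
rewrite mulr_suml mulr_sumr -big_split.
apply: eq_bigr => j _; rewrite cmM natrD scalerDl scale_ev_remU.
by rewrite (mulmC m n) scale_ev_remU [X in _ = _ + X]mulrC.
Qed.

Lemma shift_evU i : shift_ev (ucm i) = v i.+1.
Proof.
rewrite /shift_ev mdomU big_seq_fset1 cmUU scale1r.
rewrite (_ : remU _ _ = mone) ?ev1 ?mul1r //.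
by apply/eqP/cmP => j; rewrite remUE cmU subnn cm1.
Qed.

End Derivation.

(** * Bell polynomials and the shift derivation *)

Section BellRecursion.
Variables (K : fieldType) (R : comAlgType K) (v : nat -> R) (D : R -> R).
Hypotheses (lD : linear D) (DM : forall a b, D (a * b) = D a * b + a * D b).
Hypothesis Dv : forall i, D (v i) = v i.+1.
Variable b : nat -> nat -> R.
Hypothesis b_rec : forall n k,
  b n.+1 k.+1 = \sum_(i < n.+1) 'C(n, i)%:R *: (v i * b (n - i) k).
Hypothesis b0 : forall n, b n 0 = (n == 0%N)%:R.
Hypothesis b_out : forall k, b 0 k.+1 = 0.

Lemma der1 : D 1 = 0.
Proof.
by have := DM 1 1; rewrite !mulr1 mul1r => /eqP; rewrite -subr_eq subrr => /eqP<-.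
Qed.

(** The recursion that matches one more commutator with h. It follows from the
    recursion over the last block by induction on n: D turns the block factor
    v_i into v_(i+1), or acts on the rest, and Pascal's rule recombines both. *)
Lemma bell_step n k : b n.+1 k.+1 = D (b n k.+1) + v 0 * b n k.
Proof.
have s0 j : D (b j 0) = 0 by rewrite b0; case: eqP => _; rewrite ?der1 ?lin0.
have [N] := ubnP n; elim: N n k => // N IHN n k; rewrite ltnS => nN.
case: n nN => [|n] nN.
  by rewrite b_rec big_ord1 bin0 scale1r subn0 b_out lin0 // add0r.
rewrite (b_rec n) lin_sum // b_rec big_ord_recl bin0 scale1r subn0 addrC.
congr (_ + _).
pose c i := 'C(n, i)%:R *: (v i.+1 * b (n - i) k).
pose d i := 'C(n, i.+1)%:R *: (v i.+1 * b (n - i) k).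
rewrite (eq_bigr (fun i : 'I_n.+1 => c i + d i)) => [|i _]; last first.
  by rewrite /c /d -scalerDl -natrD /= /bump leq0n add1n subSS binS addnC.
rewrite [RHS](eq_bigr (fun i : 'I_n.+1 =>
   c i + 'C(n, i)%:R *: (v i * D (b (n - i) k)))) => [|i _]; last first.
  by rewrite linZ // DM Dv scalerDr.
rewrite !big_split; congr (_ + _).
case: k @c @d => [|k] c d.
  rewrite [RHS]big1 => [|i _]; last by rewrite s0 mulr0 scaler0.
  rewrite big1 // => -[i /= ni] _; rewrite /d b0 subn_eq0.
  case: leqP => i_n; last by rewrite mulr0 scaler0.
  by rewrite bin_small // mulr0n scale0r.
rewrite [RHS](eq_bigr (fun i : 'I_n.+1 => 'C(n, i)%:R *: (v i * b (n - i).+1 k.+1)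
    + - (v 0 * ('C(n, i)%:R *: (v i * b (n - i) k))))) => [|[i /= ni] _]; last first.
  rewrite (IHN (n - i)%N k) ?(leq_ltn_trans (leq_subr _ _)) //.
  by rewrite mulrDr -scalerAr mulrCA -scalerBr addrK.
rewrite big_split sumrN -mulr_sumr -b_rec /=.
rewrite [LHS]big_ord_recr [X in _ = X - _]big_ord_recl /=.
rewrite /d bin_small // mulr0n scale0r addr0 bin0 scale1r subn0 addrAC subrr add0r.
by apply: eq_bigr => i _; rewrite /= /bump leq0n add1n subnSK.
Qed.

End BellRecursion.

(** * Bialgebra axioms on generators *)

Section TensorAsAlgebra.
Variables (K : comNzRingType) (A B : algType K).
Hypothesis nz : (1 : tensor A B) != 0.

Lemma tensor_scaleAl (k : K) (x y : tensor A B) : k *: (x * y) = k *: x * y.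
Proof. by rewrite (linZ ((tensor_mul_bilinear A B).1 y)). Qed.
Lemma tensor_scaleAr (k : K) (x y : tensor A B) : k *: (x * y) = x * (k *: y).
Proof. by rewrite (linZ ((tensor_mul_bilinear A B).2 x)). Qed.

(** A tensor product is an algebra in the sense of the hierarchy only once it is
    known to be nonzero; coassociativity needs the product on a tensor product
    one of whose factors is itself a tensor product. *)
Definition tensor_nz : nzRingType := HB.pack (tensor A B)
  (GRing.PzSemiRing_isNonZero.Build (tensor A B) nz).

Definition tensor_lalg : lalgType K := HB.pack (tensor A B) tensor_nz
  (GRing.Lmodule_isLalgebra.Build K tensor_nz tensor_scaleAl).

Definition tensor_alg : algType K := HB.pack (tensor A B) tensor_lalg
  (GRing.Lalgebra_isAlgebra.Build K tensor_lalg tensor_scaleAr).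
End TensorAsAlgebra.

Lemma eq_on_subalgebra (K : fieldType) (A : algType K) (V : lmodType K)
    (mulV : V -> V -> V) (f f' : A -> V) :
  linear f -> linear f' -> f 1 = f' 1 ->
  (forall x y, f (x * y) = mulV (f x) (f y)) ->
  (forall x y, f' (x * y) = mulV (f' x) (f' y)) ->
  subalgebra [set x | f x = f' x].
Proof.
move=> lf lf' f1 fM f'M; split=> //= [k x y|x y] fx fy.
  by rewrite lf lf' fx fy.
by rewrite fM f'M fx fy.
Qed.

Definition generates (K : fieldType) (A : algType K) (G : set A) :=
  forall C : set A, subalgebra C -> G `<=` C -> forall a, C a.

Section BialgebraOnGenerators.
Variables (K : fieldType) (A : algType K) (Delta : A -> tensor A A) (eps : A -> K).
Hypotheses (lD : linear Delta) (D1 : Delta 1 = 1) (DM : {morph Delta : x y / x * y}).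
Hypotheses (le : scalar eps) (e1 : eps 1 = 1) (eM : {morph eps : x y / x * y}).
Variable G : set A.
Hypothesis genG : generates G.

Let epsK : A -> K^o := eps.
Let lepsK : linear epsK. Proof. exact: le. Qed.

Lemma scale_bilinear : bilinear_map (fun (k : K^o) (a : A) => k *: a : A).
Proof.
split=> [a|k] c x y /=; first by rewrite scalerDl -scalerA.
by rewrite scalerDr !scalerA mulrC.
Qed.

Lemma counitl_bilinear : bilinear_map (fun x y : A => eps x *: y).
Proof. exact: (bilinear_comp lepsK (@lin_id _ _) scale_bilinear). Qed.

Lemma counitr_bilinear : bilinear_map (fun x y : A => eps y *: x).
Proof. by split=> [a|a] k x y /=; rewrite ?counitl_bilinear.1 ?counitl_bilinear.2. Qed.

(** The counit separates 1 from 0 in the tensor square. *)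
Lemma augmented_nz : (1 : tensor A A) != 0.
Proof.
apply/eqP => /(congr1 (tensor_lift (fun x y : A => eps x *: y))).
rewrite tensor_lift_tens; last exact: counitl_bilinear.
rewrite (lin0 (tensor_lift_linear counitl_bilinear)) e1 scale1r.
by apply/eqP; rewrite oner_eq0.
Qed.

Local Notation AA := (tensor_alg augmented_nz).

Lemma tensor_assoc_mul (x y : tensor AA A) :
  tensor_assoc (x * y : tensor AA A) =
  (tensor_assoc x : tensor A AA) * (tensor_assoc y : tensor A AA).
Proof.
have la : linear (@tensor_assoc K A A A : tensor AA A -> tensor A AA) :=
  @tensor_assoc_linear K A A A.
have bM := tensor_mul_bilinear A AA; have bM' := tensor_mul_bilinear AA A.
have b1 := bilinear_lin la bM'; have b2 := bilinear_comp la la bM.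
have tb := tens_bilinear AA A.
apply: (tensor_linear_eq (b1.1 y) (b2.1 y)) => t c.
apply: (tensor_linear_eq (b1.2 _) (b2.2 _)) => t' c'.
rewrite tensM.
have bAA := tensor_mul_bilinear A A.
have l1 := lin_comp la (lin_comp (tb.1 (c * c')) (bAA.1 t')).
have l2 := lin_comp (bM.1 (tensor_assoc (t' ⊗ c'))) (lin_comp la (tb.1 c)).
apply: (tensor_linear_eq l1 l2) => a b /=.
have l3 := lin_comp la (lin_comp (tb.1 (c * c')) (bAA.2 (a ⊗ b))).
have l4 := lin_comp (bM.2 (tensor_assoc ((a ⊗ b) ⊗ c))) (lin_comp la (tb.1 c')).
apply: (tensor_linear_eq l3 l4) => a' b' /=.
by rewrite tensM !tensor_assoc_tens [RHS]tensM [in RHS]tensM.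
Qed.

Lemma tensor_lift_mul_morph (f : A -> A -> A) : bilinear_map f ->
  (forall a a' c c', f (a * a') (c * c') = f a c * f a' c') ->
  {morph tensor_lift f : x y / x * y}.
Proof.
move=> bf fM x y; have lf := tensor_lift_linear bf.
have b1 := bilinear_lin lf (tensor_mul_bilinear A A).
have b2 := bilinear_comp lf lf (alg_mul_bilinear A).
apply: (tensor_linear_eq (b1.1 y) (b2.1 y)) => a c.
apply: (tensor_linear_eq (b1.2 _) (b2.2 _)) => a' c'.
by rewrite tensM !(tensor_lift_tens _ _ bf) fM.
Qed.

(** All maps in the axioms are linear and multiplicative, so that the elements
    satisfying an axiom form a subalgebra. *)
Lemma bialgebra_on_generators :
  (forall a, G a -> tensor_assoc (tensor_map Delta id (Delta a)) =
                tensor_map id Delta (Delta a)) ->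
  (forall a, G a -> tensor_lift (fun x y => eps x *: y) (Delta a) = a) ->
  (forall a, G a -> tensor_lift (fun x y => eps y *: x) (Delta a) = a) ->
  is_bialgebra Delta eps.
Proof.
move=> Gassoc Gl Gr; have lid : linear (@id A) by [].
pose DA : A -> AA := Delta.
have lDA : linear DA := lD; have DAM : {morph DA : x y / x * y} := DM.
split=> //.
- have lL : linear (fun a => tensor_assoc (tensor_map Delta id (Delta a))).
    move=> k x y; rewrite lD (tensor_map_linear lD lid).
    exact: tensor_assoc_linear.
  have lR : linear (fun a => tensor_map id Delta (Delta a)).
    by move=> k x y; rewrite lD (tensor_map_linear lid lD).
  apply: (genG (eq_on_subalgebra (mulV := fun x y : tensor A AA => x * y)
    lL lR _ _ _)) => //=.
  + rewrite D1 !tensor_map_tens // D1; exact: tensor_assoc_tens.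
  + move=> x y; rewrite DM.
    rewrite (tensor_map_mul lDA lid DAM (fun x y => erefl)).
    exact: tensor_assoc_mul.
  + by move=> x y; rewrite DM; apply: (tensor_map_mul lid lDA (fun x y => erefl) DAM).
- have l := lin_comp (tensor_lift_linear counitl_bilinear) lD.
  apply: (genG (eq_on_subalgebra (mulV := fun x y : A => x * y) l lid _ _ _)) => //=.
    rewrite D1 tensor_lift_tens ?e1 ?scale1r //; exact: counitl_bilinear.
  move=> x y; rewrite DM; apply: (tensor_lift_mul_morph counitl_bilinear).
  by move=> a a' c c' /=; rewrite eM -scalerAl -scalerAr scalerA.
have l := lin_comp (tensor_lift_linear counitr_bilinear) lD.
apply: (genG (eq_on_subalgebra (mulV := fun x y : A => x * y) l lid _ _ _)) => //=.
  rewrite D1 tensor_lift_tens ?e1 ?scale1r //; exact: counitr_bilinear.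
move=> x y; rewrite DM; apply: (tensor_lift_mul_morph counitr_bilinear).
by move=> a a' c c' /=; rewrite eM -scalerAl -scalerAr scalerA.
Qed.

End BialgebraOnGenerators.

Lemma bialgebra_skew_primitive (K : fieldType) (A : algType K)
    (Delta : A -> tensor A A) (eps : A -> K) (x y : A) :
  linear Delta -> monoid_morphism Delta -> scalar eps -> monoid_morphism eps ->
  generates [set x; y] ->
  Delta x = x ⊗ x -> Delta y = 1 ⊗ y + y ⊗ x -> eps x = 1 -> eps y = 0 ->
  is_bialgebra Delta eps.
Proof.
move=> lD [D1 DM] le [e1 eM] gen Dx Dy ex ey.
have lid : linear (@id A) by [].
have [tl tr] := tens_bilinear A A; have [tl2 tr2] := tens_bilinear A (tensor A A).
have l1 := tensor_map_linear lD lid; have l2 := tensor_map_linear lid lD.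
have la := @tensor_assoc_linear K A A A.
have bl := counitl_bilinear le; have br := counitr_bilinear le.
have ll := tensor_lift_linear bl; have lr := tensor_lift_linear br.
have aD (t t' : tensor A A) (c : A) : tensor_assoc ((t + t') ⊗ c) =
    tensor_assoc (t ⊗ c) + tensor_assoc (t' ⊗ c).
  exact: (etrans (congr1 (@tensor_assoc K A A A)
    (linD ((tens_bilinear (tensor A A) A).1 c) t t')) (linD la _ _)).
apply: (bialgebra_on_generators lD D1 DM le e1 eM gen) => _ [->|->].
- by rewrite Dx !tensor_map_tens // Dx tensor_assoc_tens.
- rewrite Dy (linD l1) (linD l2) !tensor_map_tens // Dy D1 (linD la) aD.
  by rewrite !tensor_assoc_tens Dx (linD (tr2 _)) addrA.
- by rewrite Dx tensor_lift_tens // ex scale1r.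
- by rewrite Dy (linD ll) !tensor_lift_tens // e1 ey scale1r scale0r addr0.
- by rewrite Dx tensor_lift_tens // ex scale1r.
by rewrite Dy (linD lr) !tensor_lift_tens // ex ey scale1r scale0r add0r.
Qed.

(** * Bialgebra morphisms and their ranges *)

Section MorphismOnGenerators.
Variables (K : fieldType) (A B : algType K) (f : A -> B).
Hypotheses (lf : linear f) (mf : monoid_morphism f).
Variables (u : nat -> A) (e : nat -> B).
Hypotheses (genu : generates (range u)) (fu : forall n, f (u n) = e n).

Lemma range_subalgebra : subalgebra (range f).
Proof.
have [f1 fM] := mf; split; first by exists 1.
  by move=> k _ _ [x _ <-] [y _ <-]; exists (k *: x + y) => //; apply: lf.
by move=> _ _ [x _ <-] [y _ <-]; exists (x * y) => //; apply: fM.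
Qed.

Lemma range_generated : range f = smallest (@subalgebra K B) (range e).
Proof.
have [f1 fM] := mf; apply/seteqP; split; last first.
  apply: smallest_sub; first exact: range_subalgebra.
  by move=> _ [n _ <-]; exists (u n).
move=> _ [a _ <-] C [[C1 Clin CM] Ce].
apply: (genu (C := [set x | C (f x)])) => [|_ [n _ <-]]; last first.
  by rewrite /= fu; apply: Ce; exists n.
split=> /= [|k x y Cx Cy|x y Cx Cy]; first by rewrite f1.
  by rewrite lf; apply: Clin.
by rewrite fM; apply: CM.
Qed.

Variables (DA : A -> tensor A A) (DB : B -> tensor B B).
Hypotheses (lDA : linear DA) (mDA : monoid_morphism DA).
Hypotheses (lDB : linear DB) (mDB : monoid_morphism DB).

Lemma comul_on_generators :
  (forall n, DB (f (u n)) = tensor_map f f (DA (u n))) ->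
  forall a, DB (f a) = tensor_map f f (DA a).
Proof.
move=> Du; have [f1 fM] := mf; have [DA1 DAM] := mDA; have [DB1 DBM] := mDB.
have lff := tensor_map_linear lf lf; have ffM := tensor_map_mul lf lf fM fM.
apply: (genu (C := [set a | DB (f a) = tensor_map f f (DA a)])); last first.
  by move=> _ [n _ <-]; apply: Du.
apply: (eq_on_subalgebra (mulV := fun x y : tensor B B => x * y)
  (lin_comp lDB lf) (lin_comp lff lDA)) => [|x y|x y] /=.
- by rewrite f1 DA1 DB1 tensor_map_tens // f1.
- by rewrite fM DBM.
by rewrite DAM ffM.
Qed.

Lemma range_sub_bialgebra :
  (forall a, DB (f a) = tensor_map f f (DA a)) -> sub_bialgebra DB (range f).
Proof.
move=> fD; split; first exact: range_subalgebra.
move=> _ [a _ <-]; exists [seq (f p.1, f p.2) | p <- repr (DA a)]; split.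
  by move=> _ /mapP[p _ ->]; split; [exists p.1|exists p.2].
rewrite fD {1}[DA a]tensor_sum (lin_sum (tensor_map_linear lf lf)) big_map.
by apply: eq_bigr => p _; rewrite tensor_map_tens.
Qed.

Variables (epsA : A -> K) (epsB : B -> K).
Hypotheses (leA : scalar epsA) (meA : monoid_morphism epsA).
Hypotheses (leB : scalar epsB) (meB : monoid_morphism epsB).

Lemma counit_on_generators :
  (forall n, epsB (f (u n)) = epsA (u n)) -> forall a, epsB (f a) = epsA a.
Proof.
move=> eu; have [f1 fM] := mf; have [eA1 eAM] := meA; have [eB1 eBM] := meB.
apply: (genu (C := [set a | epsB (f a) = epsA a])) => [|_ [n _ <-]]; last exact: eu.
split=> /= [|k x y ex ey|x y ex ey]; first by rewrite f1 eA1 eB1.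
  by rewrite lf leA leB ex ey.
by rewrite fM eAM eBM ex ey.
Qed.

End MorphismOnGenerators.

(** * Transfer of bialgebra axioms along an injective morphism *)

Lemma eq_tensor_map (K : comNzRingType) (A B A' B' : lmodType K)
    (f f' : A -> A') (g g' : B -> B') x :
  f =1 f' -> g =1 g' -> tensor_map f g x = tensor_map f' g' x.
Proof. by move=> ff' gg'; apply: eq_bigr => p _; rewrite ff' gg'. Qed.

Section Transfer.
Variables (K : fieldType) (A B : algType K).
Variables (DA : A -> tensor A A) (DB : B -> tensor B B) (f : A -> B).
Variables (epsA : A -> K) (epsB : B -> K).
Hypotheses (lDA : linear DA) (lDB : linear DB) (lf : linear f).
Hypothesis fD : forall a, DB (f a) = tensor_map f f (DA a).
Hypothesis feps : forall a, epsB (f a) = epsA a.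

Let lid (V : lmodType K) : linear (@id V). Proof. by []. Qed.

Lemma coassocl_nat a : tensor_assoc (tensor_map DB id (DB (f a))) =
  tensor_map f (tensor_map f f) (tensor_assoc (tensor_map DA id (DA a))).
Proof.
rewrite fD tensor_map_comp // -tensor_assoc_nat // tensor_map_comp //; last first.
  exact: tensor_map_linear.
by congr (tensor_assoc _); apply: eq_tensor_map => // x; exact: fD.
Qed.

Lemma coassocr_nat a : tensor_map id DB (DB (f a)) =
  tensor_map f (tensor_map f f) (tensor_map id DA (DA a)).
Proof.
rewrite fD !tensor_map_comp //; last exact: tensor_map_linear.
by apply: eq_tensor_map => // x; exact: fD.
Qed.

Variable rho : B -> A.
Hypotheses (lrho : linear rho) (fK : cancel f rho).

Lemma tensor_map_cancel (V W V' W' : lmodType K) (k : V -> W) (r : W -> V)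
    (k' : V' -> W') (r' : W' -> V') :
  linear k -> linear r -> linear k' -> linear r' -> cancel k r -> cancel k' r' ->
  cancel (tensor_map k k') (tensor_map r r').
Proof. by move=> lk lr lk' lr' kK kK' x; rewrite tensor_map_comp // tensor_map_id. Qed.

(** The axioms hold after applying f, and tensor powers of f stay injective
    because f has a linear retraction. *)
Lemma bialgebra_injective :
  monoid_morphism DA -> scalar epsA -> monoid_morphism epsA ->
  is_bialgebra DB epsB -> is_bialgebra DA epsA.
Proof.
move=> mDA lepsA mepsA [_ [lepsB _] asB clB crB].
have lff := tensor_map_linear lf lf; have lrr := tensor_map_linear lrho lrho.
split=> // a.
- apply: (can_inj (tensor_map_cancel lf lrho lff lrr fK
    (tensor_map_cancel lf lrho lf lrho fK fK))).
  by rewrite -coassocl_nat -coassocr_nat asB.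
- apply: (can_inj fK); rewrite lin_tensor_lift // -[RHS]clB fD.
  rewrite tensor_lift_map //; last exact: counitl_bilinear.
  by apply: eq_bigr => p _; rewrite feps linZ.
apply: (can_inj fK); rewrite lin_tensor_lift // -[RHS]crB fD.
rewrite tensor_lift_map //; last exact: counitr_bilinear.
by apply: eq_bigr => p _; rewrite feps linZ.
Qed.

End Transfer.

(** * The comultiplication of iterated commutators *)

Section Comultiplication.
Variables (K : fieldType) (A : algType K) (B : comAlgType K).
Variables (x : A) (u : nat -> B) (D : B -> B) (b : nat -> nat -> B) (phi : B -> A).
Hypotheses (lD : linear D) (DM : forall a b, D (a * b) = D a * b + a * D b).
Hypothesis Du : forall i, D (u i) = u i.+1.
Hypothesis genu : generates (range u).
Hypotheses (lphi : linear phi) (phi1 : phi 1 = 1).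
Hypothesis phiM : {morph phi : a b / a * b}.
Local Notation e := (iter_ad (phi (u 0)) x).
Hypothesis phi_u : forall k, phi (u k) = e k.

(** This is the Ore relation: the commutator with x is the derivation D on the
    image of phi. *)
Lemma phi_x a : phi a * x = x * phi a + phi (D a).
Proof.
pose C : set B := [set a | phi a * x = x * phi a + phi (D a)].
apply: (genu (C := C)) => [|_ [k _ <-]]; rewrite /C /=.
  split=> /= [|k c d hc hd|c d hc hd].
  - by rewrite (der1 DM) (lin0 lphi) phi1 mulr1 mul1r addr0.
  - rewrite lphi mulrDl -scalerAl hc hd lD lphi mulrDr -scalerAr.
    by rewrite scalerDr addrACA.
  by rewrite phiM -mulrA hd mulrDr !mulrA hc mulrDl DM (linD lphi) !phiM -addrA.
by rewrite Du (phi_u k) (phi_u k.+1); apply: commutatorE.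
Qed.

Hypothesis b_step : forall n k, b n.+1 k.+1 = D (b n k.+1) + u 0 * b n k.
Hypothesis b0 : forall n, b n 0 = (n == 0%N)%:R.
Hypothesis b_out : forall n k, (n < k)%N -> b n k = 0.

(** With x skew-primitive over the group-like element phi (u 0), the tensor on the
    left is the comultiplication of the n-th iterated commutator. One more
    commutator acts on e_k (x) phi(c) by e_k (x) phi(D c) + e_(k+1) (x)
    phi(u_0 c), since phi (u 0) commutes with phi(c); this is the recursion
    [b_step] of the Bell polynomials. *)
Lemma comul_iter_ad n :
  iter_ad (phi (u 0) ⊗ phi (u 0)) (1 ⊗ x + x ⊗ phi (u 0)) n =
  \sum_(k < n.+1) e k ⊗ phi (b n.+1 k.+1).
Proof.
have [tl tr] := tens_bilinear A A.
elim: n => [|n IHn].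
  by rewrite big_ord1 b_step b_out // (lin0 lD) add0r b0 mulr1.
rewrite [LHS]/(commutator (iter_ad _ _ n) _) IHn /commutator mulr_suml mulr_sumr -sumrB.
rewrite (eq_bigr (fun k : 'I_n.+1 => e k ⊗ phi (D (b n.+1 k.+1))
    + e k.+1 ⊗ phi (u 0 * b n.+1 k.+1))) => [|k _]; last first.
  set c := b _ _; rewrite mulrDl mulrDr !tensM mul1r mulr1 phi_x.
  rewrite (linD (tr _)) -!phiM [c * _]mulrC opprD addrACA.
  rewrite [X in X + _]addrAC subrr add0r.
  by rewrite -(linB (tl _)).
rewrite [RHS](eq_bigr (fun k : 'I_n.+2 => e k ⊗ phi (D (b n.+1 k.+1))
    + e k ⊗ phi (u 0 * b n.+1 k))) => [|k _]; last first.
  by rewrite b_step (linD lphi) (linD (tr _)).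
rewrite !big_split /= [X in _ = X + _]big_ord_recr [X in _ = _ + X]big_ord_recl /=.
by rewrite b_out // (lin0 lD) b0 mulr0 (lin0 lphi) !(lin0 (tr _)) addr0 add0r.
Qed.

End Comultiplication.

(** * A right action on polynomials over a differential ring *)

Section SkewAction.
Variables (K : fieldType) (A : algType K) (B : comAlgType K).
Variables (u : nat -> B) (D : B -> B).
Hypotheses (lD : linear D) (DM : forall a b, D (a * b) = D a * b + a * D b).
Hypothesis Du : forall i, D (u i) = u i.+1.

(** Right multiplication by x on normal forms sum_i x^i b_i, read as polynomials:
    b x = x b + D b. *)
Definition mulX_der (p : {poly B}) : {poly B} := 'X * p + map_poly D p.

Lemma coef_mulX_der p i :
  (mulX_der p)`_i = (if i is j.+1 then p`_j else 0) + D p`_i.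
Proof. by rewrite coefD coefXM coef_map_id0 ?(lin0 lD) //; case: i. Qed.

Variables (x y : A) (act : A -> {poly B} -> {poly B}).
Hypothesis act_lin : forall k a a' p,
  act (k *: a + a') p = k%:A *: act a p + act a' p.
Hypothesis actM : forall a a' p, act (a * a') p = act a' (act a p).
Hypothesis act1 : forall p, act 1 p = p.
Hypothesis act_x : forall p, act x p = u 0 *: p.
Hypothesis act_y : forall p, act y p = mulX_der p.

Lemma actB a a' p : act (a - a') p = act a p - act a' p.
Proof. by rewrite addrC -scaleN1r act_lin scaleN1r scaleN1r addrC. Qed.

Lemma act_iter_ad k p : act (iter_ad x y k) p = u k *: p.
Proof.
elim: k p => [|k IHk] p; first exact: act_x.
rewrite [iter_ad _ _ _]/(commutator (iter_ad x y k) y) actB !actM !IHk !act_y.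
apply/polyP => i; rewrite coefB !coefZ !coef_mulX_der !coefZ DM Du mulrDr.
rewrite opprD addrACA addrK -[RHS]add0r; congr (_ + _).
by case: i => [|i]; rewrite ?coefZ ?mulr0 subrr.
Qed.

Lemma act_commutator i j p :
  act (commutator (iter_ad x y i) (iter_ad x y j)) p = 0.
Proof. by rewrite actB !actM !act_iter_ad !scalerA mulrC subrr. Qed.

Hypothesis actr0 : forall a, act a 0 = 0.

Lemma act_kernel_ideal : two_sided_ideal [set a | forall p, act a p = 0].
Proof.
split=> /= [p|a a' act_a act_a' p|a a' c act_c p].
- by rewrite -(subrr (1 : A)) actB subrr.
- by rewrite -[a]scale1r act_lin act_a act_a' scaler0 addr0.
by rewrite !actM act_c actr0.
Qed.

End SkewAction.

(** * The Ore extension and its commutants *)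

Section OreExtension.
Variables (K : fieldType) (A : algType K) (B : comAlgType K).
Variables (x : A) (u : nat -> B) (D : B -> B) (phi : B -> A).
Hypotheses (lD : linear D) (DM : forall a b, D (a * b) = D a * b + a * D b).
Hypothesis Du : forall i, D (u i) = u i.+1.
Hypothesis genu : generates (range u).
Hypotheses (lphi : linear phi) (phi1 : phi 1 = 1).
Hypothesis phiM : {morph phi : a b / a * b}.
Hypothesis phi_u : forall k, phi (u k) = iter_ad (phi (u 0)) x k.
Hypothesis genA : generates [set phi (u 0); x].
Variable act : A -> {poly B} -> {poly B}.
Hypothesis act_lin : forall k a a' p,
  act (k *: a + a') p = k%:A *: act a p + act a' p.
Hypothesis actM : forall a a' p, act (a * a') p = act a' (act a p).
Hypothesis act1 : forall p, act 1 p = p.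
Hypothesis act_u0 : forall p, act (phi (u 0)) p = u 0 *: p.
Hypothesis act_x : forall p, act x p = mulX_der D p.

Lemma act_phi a p : act (phi a) p = a *: p.
Proof.
move: p; pose C : set B := [set a | forall p, act (phi a) p = a *: p].
apply: (genu (C := C)) => [|_ [k _ <-] p].
  split=> /= [p|k c d hc hd p|c d hc hd p].
  - by rewrite phi1 act1 scale1r.
  - by rewrite lphi act_lin hc hd scalerDl scalerA -scalerAl mul1r.
  by rewrite phiM actM hc hd scalerA mulrC.
by rewrite phi_u; apply: act_iter_ad.
Qed.

Lemma act0 p : act 0 p = 0.
Proof. by rewrite -(subrr (1 : A)) (actB act_lin) subrr. Qed.

Lemma act_sum (I : Type) (r : seq I) (F : I -> A) p :
  act (\sum_(i <- r) F i) p = \sum_(i <- r) act (F i) p.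
Proof.
apply: (big_morph (fun a => act a p) _ (act0 p)) => a a'.
by rewrite -[a in LHS]scale1r act_lin !scale1r.
Qed.

Lemma act_xn n p : act (x ^+ n) p = iter n (mulX_der D) p.
Proof. by elim: n => [|n IHn]; rewrite ?expr0 // exprSr actM IHn act_x. Qed.

Lemma act_expansion n (r : 'I_n -> B) p :
  act (\sum_(i < n) x ^+ i * phi (r i)) p =
  \sum_(i < n) r i *: iter i (mulX_der D) p.
Proof.
by rewrite act_sum; apply: eq_bigr => i _; rewrite actM act_xn act_phi.
Qed.

(** Multiplication by X commutes with D on coefficients, so this is the binomial
    formula for (X + D)^i. *)
Lemma iter_mulX_der a i j :
  (iter i (mulX_der D) a%:P)`_j = iter (i - j) D a *+ 'C(i, j).
Proof.
have Dmn c n : D (c *+ n) = D c *+ n.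
  by elim: n => [|n IHn]; rewrite ?(lin0 lD) // !mulrS (linD lD) IHn.
elim: i j => [|i IHi] j; first by case: j => [|j]; rewrite coefC ?mulr1n.
rewrite iterS (coef_mulX_der lD) IHi Dmn -iterS.
case: j => [|j]; first by rewrite add0r !bin0 !subn0.
rewrite IHi subSS binS mulrnDr [RHS]addrC; congr (_ + _).
by case: (ltnP j i) => ij; [rewrite subnSK|rewrite bin_small].
Qed.

Lemma iter_mulX_der1 n : iter n (mulX_der D) 1 = 'X^n.
Proof.
apply/polyP => j; rewrite -polyC1 iter_mulX_der coefXn.
case: ltngtP => [jn|nj|->].
- rewrite -[(n - j)%N]prednK ?subn_gt0 // iterSr (der1 DM).
  rewrite (_ : iter _ D 0 = 0) ?mul0rn //.
  by elim: _.-1 => //= k ->; apply: lin0.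
- by rewrite bin_small.
by rewrite subnn binn.
Qed.

Definition normal_form (p : {poly B}) : A := \sum_(i < size p) x ^+ i * phi p`_i.

Lemma normal_formE n (p : {poly B}) : (size p <= n)%N ->
  normal_form p = \sum_(i < n) x ^+ i * phi p`_i.
Proof.
move=> pn; rewrite /normal_form (big_ord_widen n (fun i => x ^+ i * phi p`_i)) //.
rewrite big_mkcond; apply: eq_bigr => i _; case: ltnP => // pi.
by rewrite nth_default // (lin0 lphi) mulr0.
Qed.

Lemma normal_form_lin k p q :
  normal_form (k%:A *: p + q) = k *: normal_form p + normal_form q.
Proof.
pose n := (maxn (size p) (size q)).
have pn : (size p <= n)%N by rewrite leq_maxl.
have qn : (size q <= n)%N by rewrite leq_maxr.
rewrite (normal_formE pn) (normal_formE qn) (@normal_formE n); last first.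
  rewrite (leq_trans (size_polyD _ _)) // geq_max qn.
  by rewrite (leq_trans (size_scale_leq _ _)).
rewrite scaler_sumr -big_split; apply: eq_bigr => i _.
by rewrite coefD coefZ -scalerAl mul1r lphi mulrDr -scalerAr.
Qed.

Lemma normal_form_x p : normal_form (mulX_der D p) = normal_form p * x.
Proof.
have sp : (size (mulX_der D p) <= (size p).+1)%N.
  apply/leq_sizeP => -[//|j]; rewrite ltnS => pj.
  by rewrite (coef_mulX_der lD) !nth_default ?(lin0 lD) ?addr0 // ltnW // ltnS.
rewrite (normal_formE sp) mulr_suml.
have phx := phi_x lD DM Du genu lphi phi1 phiM phi_u.
rewrite [RHS](eq_bigr (fun i : 'I_(size p) =>
  x ^+ i.+1 * phi p`_i + x ^+ i * phi (D p`_i))) => [|i _]; last first.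
  by rewrite -mulrA phx mulrDr mulrA exprSr.
rewrite [LHS](eq_bigr (fun i : 'I_(size p).+1 =>
  x ^+ i * phi (if val i is j.+1 then p`_j else 0) + x ^+ i * phi (D p`_i))) => [|i _];
  last by rewrite (coef_mulX_der lD) (linD lphi) mulrDr.
rewrite !big_split /= [X in X + _ = _]big_ord_recl [X in _ + X = _]big_ord_recr /=.
by rewrite nth_default // (lin0 lD) !(lin0 lphi) !mulr0 add0r addr0.
Qed.

Lemma normal_form_u0 p : normal_form (u 0 *: p) = normal_form p * phi (u 0).
Proof.
rewrite (normal_formE (size_scale_leq _ _)) mulr_suml; apply: eq_bigr => i _.
by rewrite coefZ mulrC phiM mulrA.
Qed.

(** The action was designed so that taking normal forms intertwines it with
    right multiplication; on 1 this writes every element of A in normal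
    form. *)
Lemma normal_form_act a p : normal_form (act a p) = normal_form p * a.
Proof.
move: p; pose C : set A :=
  [set a | forall p, normal_form (act a p) = normal_form p * a].
apply: (genA (C := C)) => [|_ [->|->] p].
- split=> /= [p|k c d hc hd p|c d hc hd p].
  + by rewrite act1 mulr1.
  + by rewrite act_lin normal_form_lin hc hd mulrDr scalerAr.
  by rewrite actM hd hc mulrA.
- by rewrite act_u0 normal_form_u0.
by rewrite act_x normal_form_x.
Qed.

Lemma normal_formK a : normal_form (act a 1) = a.
Proof.
rewrite normal_form_act (@normal_formE 1) ?size_poly1 // big_ord1.
by rewrite coefC /= phi1 mulr1 mul1r.
Qed.

Definition retraction a : B := (act a 1)`_0.

Lemma retraction_linear : linear retraction.
Proof.
by move=> k a a'; rewrite /retraction act_lin coefD coefZ -scalerAl mul1r.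
Qed.

Lemma phiK : cancel phi retraction.
Proof. by move=> a; rewrite /retraction act_phi coefZ coefC mulr1. Qed.

(** Acting on 1 sends sum_i x^i phi(r_i) to sum_i r_i X^i, which gives the
    uniqueness of normal forms and the injectivity of phi. *)
Lemma ore_extension : is_ore_extension phi x id D.
Proof.
split; first split.
- by move=> a c; rewrite (linB lphi).
- by split.
- exact: can_inj phiK.
split.
- by split; [move=> a c|split].
- by split=> [a c|a c]; rewrite ?(linB lD) ?DM.
- exact: phi_x lD DM Du genu lphi phi1 phiM phi_u.
- move=> a; exists (size (act a 1)), (fun i => (act a 1)`_i).
  by rewrite -[LHS]normal_formK.
move=> n r r0 i; have := congr1 (fun a => (act a 1)`_i) r0.
rewrite act_expansion act0 coef0 => <-.
rewrite coef_sum (bigD1 i) //= iter_mulX_der1 coefZ coefXn eqxx mulr1.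
rewrite big1 ?addr0 // => j ji; rewrite iter_mulX_der1 coefZ coefXn.
by rewrite val_eqE eq_sym (negPf ji) mulr0.
Qed.

Hypothesis u1_regular : forall a, u 1 * a = 0 -> a = 0.

(** Let d have degree n + 1 in x, with leading coefficient p. In the commutator
    of d with u_0 the coefficient of x^n is (n + 1) u_1 p, which vanishes only
    if p does. *)
Lemma commuting_in_range d :
  [pchar K] =i pred0 -> d * phi (u 0) = phi (u 0) * d -> range phi d.
Proof.
move=> char0 dC; set p := act d 1.
have [sp|sp] := leqP (size p) 1.
  exists p`_0 => //; rewrite -[RHS]normal_formK -/p (normal_formE sp) big_ord1.
  by rewrite mul1r.
have [n sizep] : exists n, size p = n.+2 by case: (size p) sp => [|[|n]] // _; exists n.
suff : p`_n.+1 = 0.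
  move/eqP; rewrite -[n.+1]/(n.+2.-1) -sizep -lead_coefE lead_coef_eq0 => /eqP p0.
  by move: sizep; rewrite p0 size_poly0.
have := congr1 (fun a => (act a 1)`_n) dC.
(* Compare the coefficients of degree n of the two products acting on 1. *)
rewrite !actM act_phi -/p coefZ -[d in act d _]normal_formK -/p.
rewrite (normal_formE (n := n.+2)) ?sizep // act_expansion act_phi.
rewrite alg_polyC coef_sum !big_ord_recr big1 /= => [|i _]; last first.
  by rewrite coefZ iter_mulX_der bin_small // mulr0n mulr0.
rewrite add0r !coefZ -[mulX_der D _]iterS !iter_mulX_der subnn binn mulr1n subSnn binSn.
rewrite [iter 1 D _]Du [p`_n * _]mulrC /= => /eqP.
rewrite -subr_eq0 opprD addrA subrr sub0r oppr_eq0 mulrnAr -(@scaler_nat K).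
rewrite scaler_eq0 ((pcharf0P K).1 char0) /= mulrC => /eqP.
exact: u1_regular.
Qed.

End OreExtension.

(** * The free algebra *)

Lemma malg_span (K : comNzRingType) (M : monomType) (C : set {malg K[M]}) :
  (forall k x y, C x -> C y -> C (k *: x + y)) -> C 0 ->
  (forall m, C << m >>) -> forall p, C p.
Proof.
move=> Clin C0 CU p; rewrite [p]malg_sum; elim/big_rec: _ => // m q _ Cq.
exact: Clin.
Qed.

Lemma subalgebra0 (K : fieldType) (A : algType K) (C : set A) : subalgebra C -> C 0.
Proof. by case=> C1 Clin _; have := Clin (-1) _ _ C1 C1; rewrite scaleN1r addNr. Qed.

Section FreeAlgebra.
Variable K : fieldType.
Local Notation T := (free_alg K).

Lemma free_generates : generates [set letter K g; letter K h].
Proof.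
move=> C subC CG; have [C1 Clin CM] := subC.
apply: (malg_span (K := K) Clin (subalgebra0 subC)) => w.
rewrite -(fmK w); elim: (fmonom_val w) => [|a s IHs].
  by rewrite -fmoneE; exact: C1.
have -> : (FMonom (a :: s)) = mmul (fmu a) (FMonom s) :> {fmonom bool}.
  by apply/eqP; rewrite fmP fmM fmU.
have <- : letter K a * (<< FMonom s >> : T) = << mmul (fmu a) (FMonom s) >>.
  exact: malgUM.
by apply: CM IHs; apply: CG; case: a; [right|left].
Qed.

Definition word_prod (S : pzRingType) (v : bool -> S) (w : {fmonom bool}) : S :=
  \prod_(a <- (w : seq bool)) v a.

Lemma word_prodM (S : pzRingType) (v : bool -> S) w w' :
  word_prod v (mmul w w') = word_prod v w * word_prod v w'.
Proof. by rewrite /word_prod fmM big_cat. Qed.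

Lemma word_prod1 (S : pzRingType) (v : bool -> S) : word_prod v mone = 1.
Proof. by rewrite /word_prod fm1 big_nil. Qed.

Lemma word_prodU (S : pzRingType) (v : bool -> S) a : word_prod v (fmu a) = v a.
Proof. by rewrite /word_prod fmU big_seq1. Qed.

Lemma free_comul_linear : linear (@free_comul K).
Proof. exact: (@lin_ext_linear K _ _ (word_prod (letter_comul K))). Qed.

Lemma free_comul_morphism : monoid_morphism (@free_comul K).
Proof.
split; first exact: (etrans (lin_extU (word_prod (letter_comul K)) _) (word_prod1 _)).
exact: (lin_ext_mul (tensor_mul_bilinear T T) (word_prodM (letter_comul K))).
Qed.

Lemma free_comul_letter a : free_comul (letter K a) = letter_comul K a.
Proof. exact: (etrans (lin_extU (word_prod (letter_comul K)) _) (word_prodU _ a)). Qed.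

Lemma free_counit_scalar : scalar (@free_counit K).
Proof. exact: (@lin_ext_linear K _ K^o (word_prod (letter_counit K))). Qed.

Lemma free_counit_morphism : monoid_morphism (@free_counit K).
Proof.
split.
  exact: (etrans (@lin_extU K _ K^o (word_prod (letter_counit K)) _) (word_prod1 _)).
exact: (@lin_ext_mul K _ K^o _ _ (alg_mul_bilinear K^o) (word_prodM (letter_counit K))).
Qed.

Lemma free_counit_letter a : free_counit (letter K a) = letter_counit K a.
Proof.
exact: (etrans (@lin_extU K _ K^o (word_prod (letter_counit K)) _) (word_prodU _ a)).
Qed.

(** An assignment of linear operators to the two letters extends to a right
    action of the free algebra: a word acts letter by letter, from the left. *)
Section RightAction.
Variables (V : lmodType K) (step : bool -> V -> V).
Hypothesis lstep : forall a, linear (step a).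

Definition word_act (p : V) (w : {fmonom bool}) : V :=
  foldl (fun q a => step a q) p w.

Definition free_act (s : T) (p : V) : V := lin_ext (word_act p) s.

Lemma free_act_linl p : linear (free_act^~ p).
Proof. exact: lin_ext_linear. Qed.

Lemma word_act_lin w : linear (word_act^~ w).
Proof.
rewrite /word_act; elim: (w : seq bool) => [|a s IHs] k p q //=.
by rewrite lstep IHs.
Qed.

Lemma free_act_linr s : linear (free_act s).
Proof.
move=> k p q; rewrite /free_act /lin_ext scaler_sumr -big_split.
apply: eq_bigr => w _; rewrite word_act_lin scalerDr; congr (_ + _).
by rewrite !scalerA mulrC.
Qed.

Lemma free_actU w p : free_act << w >> p = word_act p w.
Proof. exact: lin_extU. Qed.

Lemma free_act_letter a p : free_act (letter K a) p = step a p.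
Proof. by rewrite /letter free_actU /word_act fmU. Qed.

Lemma free_act1 p : free_act 1 p = p.
Proof. by rewrite [LHS](free_actU mone) /word_act fm1. Qed.

Lemma free_actM s t p : free_act (s * t) p = free_act t (free_act s p).
Proof.
have b1 : bilinear_map (fun s t : T => free_act (s * t) p).
  exact: (bilinear_lin (free_act_linl p) (malg_mul_bilinear _ _)).
have b2 : bilinear_map (fun s t => free_act t (free_act s p)).
  split=> [t'|s'] k x y /=; last exact: free_act_linl.
  by rewrite free_act_linl free_act_linr.
apply: (malg_bilinear_eq b1 b2) => w w'.
have -> : (<< w >> : T) * << w' >> = << mmul w w' >> by exact: malgUM.
by rewrite !free_actU /word_act fmM foldl_cat.
Qed.

End RightAction.
End FreeAlgebra.

(** * The projection to a quotient algebra *)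

Section Quotient.
Variables (K : comNzRingType) (A : algType K) (J : Defs.proper_ideal A).

Lemma quot_pi_linear : linear (quot_pi J).
Proof.
move=> k x y; rewrite quot_piD; congr (_ + _).
exact: (esym (quot_scaleE J k x)).
Qed.

Lemma quot_pi_morphism : monoid_morphism (quot_pi J).
Proof. by split=> [//|x y]; apply: (esym (quot_mulE J x y)). Qed.

Lemma quot_pi_eq0 a : J a -> quot_pi J a = 0.
Proof. by move=> Ja; apply: quot_piP; rewrite subr0. Qed.

End Quotient.

(** * The Faa di Bruno algebra *)

Lemma cmonom_ind (P : {cmonom nat} -> Prop) :
  P mone -> (forall i m, P m -> P (mmul (ucm i) m)) -> forall m, P m.
Proof.
move=> P1 PU m; have [n] := ubnP (mdeg m); elim: n m => // n IHn m; rewrite ltnS.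
have [->//|m1 mn] := eqVneq m mone.
have [i mi] : exists i, m i != 0%N.
  apply/not_existsP => m0; case/eqP: m1; apply/eqP/cmP => i.
  by rewrite cm1; apply/eqP; move: (m0 i) => /negP; rewrite negbK.
rewrite -(divU mi); apply/PU/IHn; move: mn.
by rewrite -{1}(divU mi) mdegM mdegU add1n.
Qed.

Section FaaDiBruno.
Variable K : fieldType.
Local Notation B := (FdB K).

Lemma uC i j : u K i * u K j = u K j * u K i.
Proof. exact: mulrC. Qed.

Lemma umul i m : u K i * (<< m >> : B) = << mmul (ucm i) m >>.
Proof. exact: malgUM. Qed.

Lemma ev_u m : ev (u K) m = << m >>.
Proof.
elim/cmonom_ind: m => [|i m IHm]; first exact: ev1.
by rewrite (evM uC) evU IHm; apply: umul.
Qed.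

Lemma FdB_generates : generates (range (u K)).
Proof.
move=> C subC CG; have [C1 Clin CM] := subC.
apply: (malg_span (K := K) Clin (subalgebra0 subC)) => m.
elim/cmonom_ind: m => [|i m IHm]; first exact: C1.
rewrite -(umul i m); apply: CM IHm; apply: CG; by exists i.
Qed.

Definition FdB_shift : B -> B := lin_ext (shift_ev (u K)).

Lemma FdB_shift_linear : linear FdB_shift.
Proof. exact: lin_ext_linear. Qed.

Lemma FdB_shiftU m : FdB_shift << m >> = shift_ev (u K) m.
Proof. exact: lin_extU. Qed.

Lemma FdB_shiftM p q : FdB_shift (p * q) = FdB_shift p * q + p * FdB_shift q.
Proof.
have lS := FdB_shift_linear.
have bM : bilinear_map (fun x y : B => x * y) := malg_mul_bilinear _ _.
have b1 := bilinear_lin lS bM.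
have b2 := bilinear_comp lS (@lin_id _ _) bM.
have b3 := bilinear_comp (@lin_id _ _) lS bM.
have b23 : bilinear_map (fun p q => FdB_shift p * q + p * FdB_shift q).
  exact: bilinear_add b2 b3.
apply: (malg_bilinear_eq b1 b23) => m n.
have -> : (<< m >> : B) * << n >> = << mmul m n >> by exact: malgUM.
exact: (etrans (FdB_shiftU _) (etrans (shift_evM (u K) m n)
  (congr2 +%R (congr2 *%R (esym (FdB_shiftU m)) (ev_u n))
              (congr2 *%R (ev_u m) (esym (FdB_shiftU n)))))).
Qed.

Lemma FdB_shift_u i : FdB_shift (u K i) = u K i.+1.
Proof. exact: (etrans (FdB_shiftU _) (shift_evU _ i)). Qed.

Lemma FdB_bell_step n k :
  bell K n.+1 k.+1 = FdB_shift (bell K n k.+1) + u K 0 * bell K n k.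
Proof.
exact: (bell_step FdB_shift_linear FdB_shiftM FdB_shift_u (bell_rec K) (bell0 K)
  (fun k => bell_out K (ltn0Sn k))).
Qed.

Lemma u1_regular (a : B) : u K 1 * a = 0 -> a = 0.
Proof.
move=> a0; apply/malgP => m; rewrite mcoeff0.
have := congr1 (mcoeff (mmul (ucm 1%N) m)) a0; rewrite mcoeff0 mcoeff_uM cmM cmU /=.
suff -> : remU (mmul (ucm 1%N) m) 1 = m by [].
by apply/eqP/cmP => j; rewrite remUE cmM cmU addKn.
Qed.

Lemma u_comulC i j : u_comul K i * u_comul K j = u_comul K j * u_comul K i.
Proof. exact: tensor_mulC. Qed.

Lemma FdB_comul_linear : linear (@FdB_comul K).
Proof. exact: (@lin_ext_linear K _ _ (ev (u_comul K))). Qed.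

Lemma FdB_comul_morphism : monoid_morphism (@FdB_comul K).
Proof.
split; first exact: (etrans (lin_extU (ev (u_comul K)) _) (ev1 _)).
exact: (lin_ext_mul (tensor_mul_bilinear B B) (evM u_comulC)).
Qed.

Lemma FdB_comul_u i : FdB_comul (u K i) = u_comul K i.
Proof. exact: (etrans (lin_extU (ev (u_comul K)) _) (evU _ i)). Qed.

Lemma FdB_counit_scalar : scalar (@FdB_counit K).
Proof. exact: (@lin_ext_linear K _ K^o (ev (u_counit K))). Qed.

Lemma FdB_counit_morphism : monoid_morphism (@FdB_counit K).
Proof.
split; first exact: (etrans (@lin_extU K _ K^o (ev (u_counit K)) _) (ev1 _)).
have vC i j := mulrC (u_counit K i) (u_counit K j).
exact: (@lin_ext_mul K _ K^o _ _ (alg_mul_bilinear K^o) (evM vC)).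
Qed.

Lemma FdB_counit_u i : FdB_counit (u K i) = u_counit K i.
Proof. exact: (etrans (@lin_extU K _ K^o (ev (u_counit K)) _) (evU _ i)). Qed.

(** The universal property of the polynomial algebra, for commuting elements of
    an algebra that need not be commutative. *)
Section Universal.
Variables (A : algType K) (v : nat -> A).
Hypothesis vC : forall i j, v i * v j = v j * v i.

Definition FdB_eval : B -> A := lin_ext (ev v).

Lemma FdB_eval_linear : linear FdB_eval.
Proof. exact: lin_ext_linear. Qed.

Lemma FdB_eval_morphism : monoid_morphism FdB_eval.
Proof.
split; first exact: (etrans (lin_extU (ev v) _) (ev1 v)).
exact: (lin_ext_mul (alg_mul_bilinear A) (evM vC)).
Qed.

Lemma FdB_eval_u i : FdB_eval (u K i) = v i.
Proof. exact: (etrans (lin_extU (ev v) _) (evU v i)). Qed.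

End Universal.
End FaaDiBruno.

(** * The operators of the right action *)

Section SkewModule.
Variables (K : fieldType) (B : comAlgType K).

(** A copy of {poly B}, which is already a module over B, to be a module over K. *)
Definition skew_mod : Type := {poly B}.

HB.instance Definition _ := GRing.Zmodule.on skew_mod.

Definition skew_scale (k : K) (p : skew_mod) : skew_mod := k%:A *: (p : {poly B}).

Lemma skew_scaleA a b p : skew_scale a (skew_scale b p) = skew_scale (a * b) p.
Proof. by rewrite /skew_scale scalerA -scalerAl mul1r scalerA. Qed.
Lemma skew_scale1 : left_id 1 skew_scale.
Proof. by move=> p; rewrite /skew_scale !scale1r. Qed.
Lemma skew_scaleDr : right_distributive skew_scale +%R.
Proof. by move=> k p q; rewrite /skew_scale scalerDr. Qed.
Lemma skew_scaleDl p : {morph skew_scale^~ p : a b / a + b}.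
Proof. by move=> a b; rewrite /skew_scale !scalerDl. Qed.

HB.instance Definition _ := GRing.Zmodule_isLmodule.Build K skew_mod
  skew_scaleA skew_scale1 skew_scaleDr skew_scaleDl.

Variables (u0 : B) (D : B -> B).
Hypothesis lD : linear D.

Definition skew_step (a : bool) (p : skew_mod) : skew_mod :=
  if a == g then u0 *: (p : {poly B}) else mulX_der D p.

Lemma skew_step_linear a : linear (skew_step a).
Proof.
have mulX_der_lin k (p q : {poly B}) :
    mulX_der D (k%:A *: p + q) = k%:A *: mulX_der D p + mulX_der D q.
  apply/polyP => i; rewrite !(coef_mulX_der lD, coefD, coefZ).
  rewrite -!scalerAl !mul1r lD scalerDr addrACA; congr (_ + _).
  by case: i => [|i]; rewrite ?scaler0 ?addr0 // coefD coefZ -scalerAl mul1r.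
have scale_u0 k (p q : {poly B}) : u0 *: (k%:A *: p + q) = k%:A *: (u0 *: p) + u0 *: q.
  by rewrite scalerDr !scalerA mulrC.
move=> k p q; rewrite /skew_step.
by case: eqP => _; [apply: scale_u0|apply: mulX_der_lin].
Qed.

End SkewModule.

(** * Descent to a quotient *)

Section Descent.
Variables (K : fieldType) (T A : algType K) (pi : T -> A) (rep : A -> T).
Hypotheses (lpi : linear pi) (pi1 : pi 1 = 1) (piM : {morph pi : x y / x * y}).
Hypothesis repK : cancel rep pi.

(** Maps out of A are given on representatives, chosen by rep; on classes of
    known elements they agree with the original maps as soon as these vanish on
    the kernel. *)
Lemma descend_eq (W : zmodType) (F : T -> W) a :
  {morph F : x y / x - y} -> (forall t, pi t = 0 -> F t = 0) ->
  F (rep (pi a)) = F a.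
Proof.
move=> FB F0; apply/eqP; rewrite -subr_eq0 -FB F0 //.
by rewrite (linB lpi) repK subrr.
Qed.

Lemma descend_linear (V : lmodType K) (F : T -> V) (f : A -> V) :
  linear F -> (forall a, f (pi a) = F a) -> linear f.
Proof.
by move=> lF fpi k x y; rewrite -[x]repK -[y]repK -lpi !fpi lF.
Qed.

Lemma descend_morphism (S : pzRingType) (F : T -> S) (f : A -> S) :
  monoid_morphism F -> (forall a, f (pi a) = F a) -> monoid_morphism f.
Proof.
move=> [F1 FM] fpi; split; first by rewrite -pi1 fpi.
by move=> x y; rewrite -[x]repK -[y]repK -piM !fpi FM.
Qed.

Lemma descend_generates (a b : T) :
  generates [set a; b] -> generates [set pi a; pi b].
Proof.
move=> gen C [C1 Clin CM] Cab x; rewrite -[x]repK.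
apply: (gen [set t | C (pi t)]) => [|_ [->|->]].
- by split=> /= [|k y z|y z]; rewrite ?pi1 ?lpi ?piM; [|apply: Clin|apply: CM].
- by apply: Cab; left.
by apply: Cab; right.
Qed.

Variables (B : comAlgType K) (act : T -> {poly B} -> {poly B}).
Hypothesis act_lin : forall k a a' p,
  act (k *: a + a') p = k%:A *: act a p + act a' p.
Hypothesis actM : forall a a' p, act (a * a') p = act a' (act a p).
Hypothesis act1 : forall p, act 1 p = p.
Hypothesis act_pi0 : forall t p, pi t = 0 -> act t p = 0.

Definition descended_act (x : A) p := act (rep x) p.

Lemma descended_actE t p : descended_act (pi t) p = act t p.
Proof.
apply: (descend_eq (F := act^~ p)) => [x y|y]; last exact: act_pi0.
exact: (actB act_lin).
Qed.

Lemma descended_act_lin k x y p :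
  descended_act (k *: x + y) p = k%:A *: descended_act x p + descended_act y p.
Proof. by rewrite -[x]repK -[y]repK -lpi !descended_actE act_lin. Qed.

Lemma descended_actM x y p :
  descended_act (x * y) p = descended_act y (descended_act x p).
Proof. by rewrite -[x]repK -[y]repK -piM !descended_actE actM. Qed.

Lemma descended_act1 p : descended_act 1 p = p.
Proof. by rewrite -pi1 descended_actE act1. Qed.

End Descent.

(** * The quotient bialgebra *)

Section TbarFacts.
Variable K : fieldType.
Local Notation T := (@free_alg K).
Local Notation B := (FdB K).
Local Notation pi := (@Tbar_pi K).
Local Notation rep := (fun x : Tbar K => repr x : T).

Lemma Tbar_pi_linear : linear pi.
Proof. exact: quot_pi_linear. Qed.

Lemma Tbar_pi_morphism : monoid_morphism pi.
Proof. exact: quot_pi_morphism. Qed.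

Lemma Tbar_pi1 : pi 1 = 1.
Proof. exact: Tbar_pi_morphism.1. Qed.

Lemma Tbar_piM : {morph pi : x y / x * y}.
Proof. exact: Tbar_pi_morphism.2. Qed.

Lemma Tbar_repK : cancel rep pi.
Proof. exact: quot_piK. Qed.

Lemma Tbar_pi_ker a : pi a = 0 -> I_set a.
Proof.
move=> pia; rewrite -[a]subr0; apply: (@quot_pi_inj _ _ (I_ideal K)).
by apply: etrans pia _; rewrite -(lin0 Tbar_pi_linear).
Qed.

Lemma Tbar_pi_eq0 a : I_set a -> pi a = 0.
Proof. exact: (@quot_pi_eq0 _ _ (I_ideal K)). Qed.

Definition Tbar_g : Tbar K := pi (letter K g).
Definition Tbar_h : Tbar K := pi (letter K h).

Lemma pi_iter_ad k : pi (iter_ad (letter K g) (letter K h) k) = iter_ad Tbar_g Tbar_h k.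
Proof. exact: iter_ad_morph (linB Tbar_pi_linear) Tbar_piM. Qed.

Lemma calE_iter_ad k : calE K k = iter_ad Tbar_g Tbar_h k.
Proof. exact: (etrans (congr1 pi (E_omega K k)) (pi_iter_ad k)). Qed.

(** The commutators of the iterated brackets belong to the ideal. *)
Lemma calEC i j : calE K i * calE K j = calE K j * calE K i.
Proof.
rewrite (calE_iter_ad i) (calE_iter_ad j) -(pi_iter_ad i) -(pi_iter_ad j).
set a := iter_ad _ _ i; set b := iter_ad _ _ j.
rewrite -(Tbar_piM a b) -(Tbar_piM b a); apply/eqP; rewrite -subr_eq0.
rewrite -(linB Tbar_pi_linear (a * b) (b * a)); apply/eqP/Tbar_pi_eq0.
exact: I_set_commutator.
Qed.

Definition phi : B -> Tbar K := FdB_eval (calE K).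

Lemma phi_linear : linear phi.
Proof. exact: FdB_eval_linear. Qed.

Lemma phi_morphism : monoid_morphism phi.
Proof. exact: FdB_eval_morphism calEC. Qed.

Lemma phi_calE k : phi (u K k) = calE K k.
Proof. exact: (FdB_eval_u (calE K) k). Qed.

Lemma phi_u0 : phi (u K 0) = Tbar_g.
Proof. exact: (etrans (phi_calE 0) (calE_iter_ad 0)). Qed.

Lemma phi_iter_ad k : phi (u K k) = iter_ad (phi (u K 0)) Tbar_h k.
Proof.
exact: (etrans (phi_calE k) (etrans (calE_iter_ad k)
  (congr1 (fun a => iter_ad a Tbar_h k) (esym phi_u0)))).
Qed.

Lemma Tbar_generates : generates [set Tbar_g; Tbar_h].
Proof.
exact: (descend_generates Tbar_pi_linear Tbar_pi1 Tbar_piM Tbar_repK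
  (@free_generates K)).
Qed.

(** The comultiplication of the quotient, before it is known to be well
    defined. *)
Definition pi_comul (t : T) : tensor (Tbar K) (Tbar K) :=
  tensor_map pi pi (free_comul t).

Lemma pi_comul_linear : linear pi_comul.
Proof.
exact: (lin_comp (tensor_map_linear Tbar_pi_linear Tbar_pi_linear)
                 (@free_comul_linear K)).
Qed.

Lemma pi_comul_morphism : monoid_morphism pi_comul.
Proof.
have pi2M := tensor_map_mul Tbar_pi_linear Tbar_pi_linear Tbar_piM Tbar_piM.
have pi2U := tensor_map_tens _ _ Tbar_pi_linear Tbar_pi_linear.
split.
  rewrite /pi_comul (@free_comul_morphism K).1.
  by rewrite [LHS]pi2U Tbar_pi1.
by move=> x y; rewrite /pi_comul (@free_comul_morphism K).2; apply: pi2M.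
Qed.

Lemma pi_comul_g : pi_comul (letter K g) = Tbar_g ⊗ Tbar_g.
Proof.
rewrite /pi_comul (@free_comul_letter K g).
exact: (tensor_map_tens _ _ Tbar_pi_linear Tbar_pi_linear).
Qed.

Lemma pi_comul_h : pi_comul (letter K h) = 1 ⊗ Tbar_h + Tbar_h ⊗ Tbar_g.
Proof.
have pi2U := tensor_map_tens _ _ Tbar_pi_linear Tbar_pi_linear.
rewrite /pi_comul (free_comul_letter K h).
rewrite [LHS](linD (tensor_map_linear Tbar_pi_linear Tbar_pi_linear)).
apply: congr2; last exact: pi2U.
by rewrite [LHS]pi2U Tbar_pi1.
Qed.

(** This single computation has two consequences: the ideal is a coideal, since
    the right-hand sides lie in a commutative ring, and phi respects the
    comultiplications. *)
Lemma pi_comul_iter_ad n : pi_comul (iter_ad (letter K g) (letter K h) n) =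
  tensor_map phi phi (u_comul K n).
Proof.
have lphi := phi_linear; have phi2U := tensor_map_tens _ _ lphi lphi.
rewrite (iter_ad_morph _ _ _ (linB pi_comul_linear) pi_comul_morphism.2).
rewrite pi_comul_g pi_comul_h -phi_u0.
rewrite (comul_iter_ad (@FdB_shift_linear K) (@FdB_shiftM K) (@FdB_shift_u K)
  (@FdB_generates K) lphi phi_morphism.1 phi_morphism.2 phi_iter_ad
  (@FdB_bell_step K) (@bell0 K) (@bell_out K)).
rewrite /u_comul (lin_sum (tensor_map_linear lphi lphi)).
apply: eq_bigr => k _.
exact: (etrans (congr1 (fun a => a ⊗ phi (bell K n.+1 k.+1)) (esym (phi_iter_ad k)))
  (esym (phi2U (u K k) (bell K n.+1 k.+1)))).
Qed.

Lemma pi_comul_ker t : pi t = 0 -> pi_comul t = 0.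
Proof.
have phi2M := tensor_map_mul phi_linear phi_linear phi_morphism.2 phi_morphism.2.
move/Tbar_pi_ker; apply: I_set_kernel.
- exact: linB pi_comul_linear.
- exact: pi_comul_morphism.2.
move=> i j; rewrite (pi_comul_iter_ad i) (pi_comul_iter_ad j) -[LHS]phi2M -[RHS]phi2M.
by congr (tensor_map _ _ _); apply: tensor_mulC.
Qed.

Lemma Tbar_comul_pi t : Tbar_comul (pi t) = pi_comul t.
Proof.
have desc := descend_eq (F := pi_comul) Tbar_pi_linear Tbar_repK.
exact: desc (linB pi_comul_linear) pi_comul_ker.
Qed.

Lemma free_counit_ker t : pi t = 0 -> free_counit t = 0.
Proof.
move/Tbar_pi_ker; apply: I_set_kernel.
- exact: (@linB K T K^o _ (@free_counit_scalar K)).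
- exact: (@free_counit_morphism K).2.
by move=> i j; apply: mulrC.
Qed.

Lemma Tbar_counit_pi t : Tbar_counit (pi t) = free_counit t.
Proof.
have desc := descend_eq (F := @free_counit K) Tbar_pi_linear Tbar_repK.
apply: desc free_counit_ker.
exact: (@linB K T K^o _ (@free_counit_scalar K)).
Qed.

Lemma Tbar_comul_linear : linear (@Tbar_comul K).
Proof.
exact: (descend_linear Tbar_pi_linear Tbar_repK pi_comul_linear Tbar_comul_pi).
Qed.

Lemma Tbar_comul_morphism : monoid_morphism (@Tbar_comul K).
Proof.
exact: (descend_morphism Tbar_pi1 Tbar_piM Tbar_repK pi_comul_morphism Tbar_comul_pi).
Qed.

Lemma Tbar_counit_scalar : scalar (@Tbar_counit K).
Proof.
exact: (@descend_linear K T (Tbar K) pi rep Tbar_pi_linear Tbar_repK K^o _ _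
  (@free_counit_scalar K) Tbar_counit_pi).
Qed.

Lemma Tbar_counit_morphism : monoid_morphism (@Tbar_counit K).
Proof.
exact: (descend_morphism Tbar_pi1 Tbar_piM Tbar_repK (@free_counit_morphism K)
  Tbar_counit_pi).
Qed.

Lemma Tbar_comul_g : Tbar_comul Tbar_g = Tbar_g ⊗ Tbar_g.
Proof. exact: (etrans (Tbar_comul_pi _) pi_comul_g). Qed.

Lemma Tbar_comul_h : Tbar_comul Tbar_h = 1 ⊗ Tbar_h + Tbar_h ⊗ Tbar_g.
Proof. exact: (etrans (Tbar_comul_pi _) pi_comul_h). Qed.

Lemma Tbar_counit_g : Tbar_counit Tbar_g = 1.
Proof. exact: (etrans (Tbar_counit_pi _) (free_counit_letter K g)). Qed.

Lemma Tbar_counit_h : Tbar_counit Tbar_h = 0.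
Proof. exact: (etrans (Tbar_counit_pi _) (free_counit_letter K h)). Qed.

Lemma pi_bialgebra_morphism : bialgebra_morphism (@free_comul K) (@free_counit K)
  (@Tbar_comul K) (@Tbar_counit K) pi.
Proof.
split; [exact: Tbar_pi_linear|exact: Tbar_pi_morphism|exact: Tbar_comul_pi|].
exact: Tbar_counit_pi.
Qed.
Lemma phi_comul_u n :
  Tbar_comul (phi (u K n)) = tensor_map phi phi (FdB_comul (u K n)).
Proof.
have phi_pi : phi (u K n) = pi (iter_ad (letter K g) (letter K h) n).
  exact: (etrans (phi_calE n) (congr1 pi (E_omega K n))).
rewrite phi_pi (@FdB_comul_u K n).
exact: (etrans (Tbar_comul_pi _) (pi_comul_iter_ad n)).
Qed.

Lemma phi_counit_u n : Tbar_counit (phi (u K n)) = FdB_counit (u K n).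
Proof.
rewrite (@FdB_counit_u K n) (phi_calE n) (calE_iter_ad n).
have [_ eM] := Tbar_counit_morphism.
have eB : {morph @Tbar_counit K : x y / x - y}.
  exact: (@linB K (Tbar K) K^o _ Tbar_counit_scalar).
case: n => [|n]; first exact: Tbar_counit_g.
(* The counit of a commutator is a commutator in the field. *)
apply: etrans (_ : commutator (Tbar_counit (iter_ad Tbar_g Tbar_h n))
  (Tbar_counit Tbar_h) = 0).
  exact: (etrans (eB _ _) (congr2 (fun a b => a - b) (eM _ _) (eM _ _))).
by rewrite /commutator mulrC subrr.
Qed.

End TbarFacts.

(** * The action of the quotient, and the conclusion *)

Section SkewActionOfTbar.
Variable K : fieldType.
Local Notation T := (free_alg K).
Local Notation B := (FdB K).
Local Notation pi := (@Tbar_pi K).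

Definition skew_act (t : T) (p : {poly B}) : {poly B} :=
  free_act (skew_step (u K 0) (@FdB_shift K)) t (p : skew_mod B).

Let lstep := skew_step_linear (u K 0) (@FdB_shift_linear K).

Lemma skew_act_lin k a a' p :
  skew_act (k *: a + a') p = k%:A *: skew_act a p + skew_act a' p.
Proof. exact: (@free_act_linl K (skew_mod B) (skew_step _ _) p k a a'). Qed.

Lemma skew_actM a a' p : skew_act (a * a') p = skew_act a' (skew_act a p).
Proof. exact: (free_actM lstep). Qed.

Lemma skew_act1 p : skew_act 1 p = p.
Proof. exact: (@free_act1 K (skew_mod B) (skew_step _ _) p). Qed.

Lemma skew_act_g p : skew_act (letter K g) p = u K 0 *: p.
Proof. exact: (@free_act_letter K (skew_mod B) (skew_step _ _) g p). Qed.

Lemma skew_act_h p : skew_act (letter K h) p = mulX_der (@FdB_shift K) p.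
Proof. exact: (@free_act_letter K (skew_mod B) (skew_step _ _) h p). Qed.

Lemma skew_actr0 t : skew_act t 0 = 0.
Proof. exact: lin0 (free_act_linr lstep t). Qed.

(** The iterated brackets act as multiplications by the variables, which
    commute; hence the whole ideal acts by 0. *)
Lemma skew_act_ker t p : pi t = 0 -> skew_act t p = 0.
Proof.
move/Tbar_pi_ker => It; move: p.
have ker := act_kernel_ideal skew_act_lin skew_actM skew_actr0.
have comm := act_commutator (@FdB_shift_linear K) (@FdB_shiftM K) (@FdB_shift_u K)
  skew_act_lin skew_actM skew_act_g skew_act_h.
exact: (I_set_sub ker comm It).
Qed.

End SkewActionOfTbar.

Theorem theorem2p19 (K : fieldType) :
  [/\ is_bialgebra (@FdB_comul K) (@FdB_counit K),
      is_bialgebra (@Tbar_comul K) (@Tbar_counit K),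
      bialgebra_morphism (@free_comul K) (@free_counit K)
        (@Tbar_comul K) (@Tbar_counit K) (@Tbar_pi K)
    & exists phi : FdB K -> Tbar K,
      [/\ (forall n, phi (u K n) = calE K n) /\ injective phi /\
            bialgebra_morphism (@FdB_comul K) (@FdB_counit K)
              (@Tbar_comul K) (@Tbar_counit K) phi,
          range phi = smallest (@subalgebra K (Tbar K)) (range (calE K)) /\
            sub_bialgebra (@Tbar_comul K) (range phi),
          exists (x : Tbar K) (sigma delta : FdB K -> FdB K),
            is_ore_extension phi x sigma delta
        & [pchar K] =i pred0 ->
            maximal_commutative_sub_bialgebra (@Tbar_comul K) (range phi)]].
Proof.
have lphi := @phi_linear K; have mphi := @phi_morphism K.
pose tact := descended_act (fun x : Tbar K => repr x : free_alg K) (@skew_act K).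
have tactE : forall t p, tact (Tbar_pi t) p = skew_act t p :=
  descended_actE (@Tbar_pi_linear K) (@Tbar_repK K) (@skew_act_lin K)
    (fun t p => @skew_act_ker K t p).
have tact_lin := descended_act_lin (@Tbar_pi_linear K) (@Tbar_repK K) (@skew_act_lin K)
    (fun t p => @skew_act_ker K t p).
have tactM := descended_actM (@Tbar_pi_linear K) (@Tbar_piM K) (@Tbar_repK K)
  (@skew_act_lin K) (@skew_actM K) (fun t p => @skew_act_ker K t p).
have tact1 := descended_act1 (@Tbar_pi_linear K) (@Tbar_pi1 K) (@Tbar_repK K)
  (@skew_act_lin K) (@skew_act1 K) (fun t p => @skew_act_ker K t p).
have tact_u0 p : tact (phi (u K 0)) p = u K 0 *: p.
  exact: (etrans (congr1 (fun a => tact a p) (phi_u0 K))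
    (etrans (tactE _ p) (skew_act_g p))).
have tact_h p : tact (Tbar_h K) p = mulX_der (@FdB_shift K) p.
  exact: (etrans (tactE _ p) (skew_act_h p)).
have genA : generates [set phi (u K 0); Tbar_h K].
  have := @Tbar_generates K; by rewrite -phi_u0.
have phiK := phiK (@FdB_shift_linear K) (@FdB_shiftM K) (@FdB_shift_u K)
  (@FdB_generates K) lphi mphi.1 mphi.2 (@phi_iter_ad K)
  tact_lin tactM tact1 tact_u0 tact_h.
have bialgT : is_bialgebra (@Tbar_comul K) (@Tbar_counit K).
  exact: (bialgebra_skew_primitive (@Tbar_comul_linear K) (@Tbar_comul_morphism K)
    (@Tbar_counit_scalar K) (@Tbar_counit_morphism K) (@Tbar_generates K)
    (Tbar_comul_g K) (Tbar_comul_h K) (Tbar_counit_g K) (Tbar_counit_h K)).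
have phi_comul := comul_on_generators lphi mphi (@FdB_generates K)
  (@FdB_comul_linear K) (@FdB_comul_morphism K) (@Tbar_comul_linear K)
  (@Tbar_comul_morphism K) (@phi_comul_u K).
have phi_counit := counit_on_generators lphi mphi (@FdB_generates K)
  (@FdB_counit_scalar K) (@FdB_counit_morphism K) (@Tbar_counit_scalar K)
  (@Tbar_counit_morphism K) (@phi_counit_u K).
have bialgF := bialgebra_injective (@FdB_comul_linear K) (@Tbar_comul_linear K) lphi
  phi_comul phi_counit (retraction_linear tact_lin) phiK (@FdB_comul_morphism K)
  (@FdB_counit_scalar K) (@FdB_counit_morphism K) bialgT.
split; [exact: bialgF|exact: bialgT|exact: pi_bialgebra_morphism|].
have sub_range := range_sub_bialgebra lphi mphi phi_comul.
exists (@phi K); split.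
- split; first exact: phi_calE.
  split; first exact: can_inj phiK.
  by split.
- split; last exact: sub_range.
  exact: (range_generated lphi mphi (@FdB_generates K) (@phi_calE K)).
- exists (Tbar_h K), id, (@FdB_shift K).
  exact: (ore_extension (@FdB_shift_linear K) (@FdB_shiftM K) (@FdB_shift_u K)
    (@FdB_generates K) lphi mphi.1 mphi.2 (@phi_iter_ad K) genA
    tact_lin tactM tact1 tact_u0 tact_h).
move=> char0; split; first exact: sub_range.
  move=> _ _ [a _ <-] [b _ <-].
  exact: (etrans (esym (mphi.2 a b))
    (etrans (congr1 (@phi K) (mulrC a b)) (mphi.2 b a))).
(* Commuting with phi (u 0) alone already forces an element into the range. *)
move=> C _ Ccomm phiC; apply/seteqP; split=> // d Cd.
apply: (commuting_in_range (@FdB_shift_linear K) (@FdB_shiftM K) (@FdB_shift_u K)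
    (@FdB_generates K) lphi mphi.1 mphi.2 (@phi_iter_ad K) genA
    tact_lin tactM tact1 tact_u0 tact_h (@u1_regular K) char0).
by apply: Ccomm => //; apply: phiC; exists (u K 0).
Qed.
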